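(* As $Q\to\infty$, for all but $o(Q/\log Q)$ primes $p\in[Q,2Q]$ we have $$M(p)\le p^{4/3+o(1)}.$$
   Context: An integer $n$ is $y$-smooth if all prime divisors of $n$ do not exceed $y$; it is square-free if it is not divisible by the square of a prime. For a prime $p$, $M(p)$ denotes the smallest integer $M$ such that every residue class modulo $p$ (including the class of $0$) contains a positive $p$-smooth square-free representative not exceeding $M$; $M(p)=\infty$ if no such $M$ exists. The $o(1)$ in the exponent is a quantity tending to $0$ as $Q\to\infty$. *)

(* Defs.v *)
From mathcomp Require Import all_boot all_order all_algebra.
From mathcomp Require Import finmap.
From mathcomp Require Import all_classical all_reals all_analysis.
Import Order.TTheory GRing.Theory Num.Theory.
Import numFieldNormedType.Exports.

Set Implicit Arguments.
Unset Strict Implicit.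
Unset Printing Implicit Defensive.

Local Open Scope ring_scope.
Local Open Scope classical_set_scope.

(* Makes the Landau notation [f =o_ (pinfty_nbhs R) g] available. *)
Canonical pinfty_filter_on (R : numFieldType) :=
  FilterType (pinfty_nbhs R) _.

Definition smooth (y n : nat) : Prop :=
  forall q : nat, prime q -> (q %| n)%N -> (q <= y)%N.

Definition squarefree (n : nat) : Prop :=
  forall q : nat, prime q -> ~~ (q ^ 2 %| n)%N.

Definition represents_all_classes (p m : nat) : Prop :=
  forall a : nat, exists n : nat,
    [/\ (0 < n <= m)%N, smooth p n, squarefree n & (n = a %[mod p])%N].

Definition M (R : realType) (p : nat) : \bar R :=
  if pselect (exists m, `[< represents_all_classes p m >]) is left exm
  then (ex_minn exm)%:R%:E else +oo%E.

Definition exceptional_primes (R : realType) (e : R -> R) (Q : R) : set nat :=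
  [set p | [/\ prime p, Q <= p%:R <= 2 * Q
             & ~ (M R p <= (p%:R `^ (4 / 3 + e Q))%:E)%E]].

(* [fset_set] sends infinite sets to the empty one, so finiteness is what makes
   [#|` fset_set (exceptional_primes e Q)|] the actual number of exceptions. *)
Lemma finite_exceptional_primes (R : realType) (e : R -> R) (Q : R) :
  finite_set (exceptional_primes e Q).
Proof.
apply: (@sub_finite_set _ _ `I_(Num.truncn (2 * Q)).+1); last exact: finite_II.
move=> p [_ /andP[_ pQ] _] /=; rewrite ltnS -(@natrK R p).
exact: le_truncn.
Qed.

(* Main.v *)
(* Represent a class [a] mod [p] by [n = u * v * w] with primes [v], [w] and
   [u < p], of sizes about [p], [p ^ (1 / 12)] and [p ^ (1 / 4)]: such [n] are
   automatically [p]-smooth.  For almost all [p], the congruence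
   [1/w1 + .. + 1/w4 = 1/w5 + .. + 1/w8] mod [p] has few solutions besides those
   with every value repeated, because a nonzero numerator has few prime divisors.
   This bounds the eighth moment over [h] of [sum_w e(h/w)], hence, by Hoelder's
   inequality in [v], every double sum [sum_v sum_w e(h/(v w))] with [h != 0];
   so the residues [a/(v w)] are equidistributed in intervals slightly shorter
   than [p], also after division by [q ^ 2] for small primes [q].  As
   [sum_q 1/q^2 < 1/2], a positive proportion of the pairs [(v, w)] gives a [u]
   without small square divisor, about [p ^ (1 / 3)] pairs in total.

   It remains to see that fewer [n <= N], with [N] about [p ^ (4 / 3)] and
   [n = a] mod [p], are multiples of [q ^ 2] for a larger prime [q].  This is
   trivial for [q] below [p ^ (1 / 4)] (one progression per [q]) and for [q]
   above [p ^ (1 / 2)] (two solutions [q] per cofactor).  In between, if [R] primes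
   [q] of size [D] occur, all [a (1/q1^2 + 1/q2^2)] lie in an interval of length
   [2 N / D^2], so [R ^ 4] is at most that length times the number of solutions
   of [1/q1^2 + 1/q2^2 = 1/q3^2 + 1/q4^2] mod [p], which for almost all [p] is
   about [D ^ 2].  Then [R <= N ^ (1 / 4)], smaller than [N / p] as soon as [N]
   exceeds [p ^ (4 / 3)]. *)
Require Import Defs.
From mathcomp Require Import all_boot all_order all_algebra.
From mathcomp Require Import finmap.
From mathcomp Require Import all_classical all_reals all_analysis.
From mathcomp Require Import algC cyclotomic zify ring lra.
Import Order.TTheory GRing.Theory Num.Theory.
Import numFieldNormedType.Exports.
From mathcomp Require Import fintype finset.

Set Implicit Arguments.
Unset Strict Implicit.
Unset Printing Implicit Defensive.

Local Open Scope ring_scope.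

(** * Bilinear sums of additive characters *)

(** Lagrange's identity: twice the difference of the two sides is the double sum of the squares of
    [a i * b j - a j * b i], which are real because [a] and [b] are nonnegative. It serves both over
    [algC] and over the integers. *)
Lemma cauchy_schwarz (F : numDomainType) (T : finType) (P : pred T) (a b : T -> F) :
  (forall i, 0 <= a i) -> (forall i, 0 <= b i) ->
  (\sum_(i | P i) a i * b i) ^+ 2 <=
    (\sum_(i | P i) a i ^+ 2) * (\sum_(i | P i) b i ^+ 2).
Proof.
move=> a0 b0; rewrite -subr_ge0 -(pmulr_lge0 _ (ltr0Sn F 1)).
suff -> : ((\sum_(i | P i) a i ^+ 2) * (\sum_(i | P i) b i ^+ 2)
           - (\sum_(i | P i) a i * b i) ^+ 2) * 2%:R
   = \sum_(i | P i) \sum_(j | P j) (a i * b j - a j * b i) ^+ 2.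
  apply: sumr_ge0 => i _; apply: sumr_ge0 => j _.
  by rewrite real_exprn_even_ge0 // rpredB // ger0_real ?mulr_ge0.
rewrite expr2 !big_distrlr /= mulr_natr mulr2n [X in _ = X](eq_bigr (fun i =>
  \sum_(j | P j) (a i ^+ 2 * b j ^+ 2 - a i * b i * (a j * b j)) +
  \sum_(j | P j) (a j ^+ 2 * b i ^+ 2 - a i * b i * (a j * b j)))).
  rewrite big_split /=; congr (_ + _).
    by rewrite -sumrB; apply: eq_bigr => i _; rewrite sumrB.
  rewrite [in RHS]exchange_big /= -sumrB; apply: eq_bigr => i _; rewrite -sumrB.
  by apply: eq_bigr => j _; congr (_ - _); rewrite mulrC.
move=> i _; rewrite -big_split /=; apply: eq_bigr => j _; ring.
Qed.

Lemma sqr_sum_le (F : numDomainType) (T : finType) (A : {set T}) (a : T -> F) :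
  (forall i, 0 <= a i) ->
  (\sum_(i in A) a i) ^+ 2 <= #|A|%:R * \sum_(i in A) a i ^+ 2.
Proof.
move=> a0; rewrite mulrC.
have := @cauchy_schwarz F T (mem A) a (fun=> 1) a0 (fun=> ler01).
by under eq_bigr do rewrite mulr1; under [X in _ * X]eq_bigr do rewrite expr1n;
   rewrite sumr_const.
Qed.

(** Hoelder's inequality for exponent 8, by Cauchy-Schwarz three times, doubling the exponent each
    time. *)
Lemma pow8_sum_le (F : numDomainType) (T : finType) (A : {set T}) (a : T -> F) :
  (forall i, 0 <= a i) ->
  (\sum_(i in A) a i) ^+ 8 <= #|A|%:R ^+ 7 * \sum_(i in A) a i ^+ 8.
Proof.
move=> a0; have ge0 n : 0 <= \sum_(i in A) a i ^+ n.
  by apply: sumr_ge0 => i _; rewrite exprn_ge0.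
have c0 : 0 <= #|A|%:R :> F by [].
have sq x y : 0 <= x -> x <= y -> x ^+ 2 <= y ^+ 2 :> F.
  by move=> x0 xy; rewrite lerXn2r // nnegrE // (le_trans x0).
have h1 := sqr_sum_le A a0.
have h2 : (\sum_(i in A) a i ^+ 2) ^+ 2 <= #|A|%:R * \sum_(i in A) a i ^+ 4.
  apply: le_trans (sqr_sum_le A _) _ => [i|]; first exact: exprn_ge0.
  by under eq_bigr do rewrite -exprM.
have h3 : (\sum_(i in A) a i ^+ 4) ^+ 2 <= #|A|%:R * \sum_(i in A) a i ^+ 8.
  apply: le_trans (sqr_sum_le A _) _ => [i|]; first exact: exprn_ge0.
  by under eq_bigr do rewrite -exprM.
have g1 : 0 <= \sum_(i in A) a i by apply: sumr_ge0.
have := sq _ _ (exprn_ge0 _ g1) h1; rewrite -exprM exprMn => k1.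
have {}k1 : (\sum_(i in A) a i) ^+ (2 * 2) <= #|A|%:R ^+ 3 * \sum_(i in A) a i ^+ 4.
  by apply: le_trans k1 _; rewrite [_ ^+ 3]exprSr -mulrA ler_wpM2l ?exprn_ge0.
have := sq _ _ (exprn_ge0 _ g1) k1; rewrite -exprM exprMn -exprM => {}k1.
by apply: le_trans k1 _; rewrite [_ ^+ 7]exprSr -mulrA ler_wpM2l ?exprn_ge0.
Qed.

Section Fourier.
Variables (K : finFieldType) (psi : K -> algC).
Hypotheses (psiD : {morph psi : x y / x + y >-> x * y}).
Hypothesis psi_norm : forall x, `|psi x| = 1.
Hypothesis psi_nt : exists x, psi x != 1.

Let psi0 : psi 0 = 1.
Proof.
have nz : psi 0 != 0 by rewrite -normr_eq0 psi_norm oner_eq0.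
by apply: (mulfI nz); rewrite mulr1 -psiD addr0.
Qed.

Let psi_conj x : (psi x)^* = psi (- x).
Proof.
have nz : psi x != 0 by rewrite -normr_eq0 psi_norm oner_eq0.
apply: (mulfI nz); rewrite -normCK psi_norm -psiD subrr psi0; exact: expr1n.
Qed.

Let psi_sum (I : Type) (r : seq I) (P : pred I) (F : I -> K) :
  psi (\sum_(i <- r | P i) F i) = \prod_(i <- r | P i) psi (F i).
Proof. exact: (big_morph psi psiD psi0). Qed.

Lemma sum_character x : \sum_h psi (h * x) = (#|K| * (x == 0))%:R.
Proof.
case: eqVneq => [->|x0].
  by rewrite muln1; under eq_bigr do rewrite mulr0 psi0; rewrite sumr_const.
rewrite muln0; have [y py] := psi_nt.
rewrite (reindex_onto (fun k => k / x) (fun k => k * x)) /=; last first.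
  by move=> k _; rewrite mulfK.
under eq_bigl do rewrite divfK // eqxx.
under eq_bigr do rewrite divfK //.
(* Translation by [y] permutes the terms and multiplies the sum by [psi y], which differs from 1. *)
set S := \sum_ _ _; have : S * psi y = S.
  rewrite {2}/S (reindex_inj (addIr y)) /= mulr_suml.
  by apply: eq_bigr => k _; rewrite psiD.
move/eqP; rewrite -subr_eq0 -{2}[S]mulr1 -mulrBr mulf_eq0 subr_eq0 (negbTE py) orbF.
by move/eqP.
Qed.

Lemma parseval_set (I : {set K}) :
  \sum_h `|\sum_(i in I) psi (h * i)| ^+ 2 = (#|K| * #|I|)%:R.
Proof.
under eq_bigr => h _.
  rewrite normCK rmorph_sum big_distrlr /=.
  under eq_bigr do under eq_bigr do rewrite psi_conj -psiD -mulrBr.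
  over.
rewrite exchange_big /=; under eq_bigr do rewrite exchange_big /=.
under eq_bigr do under eq_bigr do rewrite sum_character subr_eq0.
under eq_bigr => i Ii.
  rewrite (bigD1 i) //= eqxx muln1 big1 ?addr0; last first.
    by move=> j /andP[_]; rewrite eq_sym => /negbTE->; rewrite muln0.
  over.
by rewrite sumr_const natrM mulr_natr.
Qed.

Variables (T1 T2 : finType) (b1 : T1 -> K) (b2 : T2 -> K).

(** For even [n] this is an additive energy; the alternating signs match the alternation of factors
    and conjugates in a power of a norm. *)
Definition energy n (B : {set T2}) : nat :=
  #|[set f : {ffun 'I_n -> T2} | [forall i, f i \in B] &&
      (\sum_(i < n) (-1) ^+ i * b2 (f i) == 0)]|.

(** The eighth power of a norm is a product of four factors and four conjugates; after expansion,
    orthogonality in [x] leaves the solutions of the alternating equation. *)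
Lemma moment8 (B : {set T2}) :
  \sum_x `|\sum_(w in B) psi (x * b2 w)| ^+ 8 = (#|K| * energy 8 B)%:R.
Proof.
have pow8 (z : algC) : `|z| ^+ 8 = \prod_(i < 8) (if odd i then z^* else z).
  rewrite (exprM _ 2 4) normCK !big_ord_recl big_ord0 /= mulr1; ring.
under eq_bigr => x _.
  rewrite pow8; under eq_bigr => i _.
    rewrite (_ : (if _ then _ else _) =
             \sum_(w in B) psi (x * ((-1) ^+ i * b2 w))); last first.
      case: ifP => oi; last first.
        by apply: eq_bigr => w _; rewrite -signr_odd oi expr0 mul1r.
      rewrite rmorph_sum; apply: eq_bigr => w _.
      by rewrite /= psi_conj -signr_odd oi expr1 mulN1r mulrN.
    over.
  rewrite bigA_distr_big /=; under eq_bigr do rewrite -psi_sum -mulr_sumr.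
  over.
rewrite exchange_big /=; under eq_bigr do rewrite sum_character.
rewrite -natr_sum -big_distrr /=; congr (_ * _)%:R.
rewrite /energy -sum1dep_card big_mkcondr /=; apply: eq_big => f.
  by apply/familyP/forallP.
by case: eqP.
Qed.

(** Hoelder in [v] brings the eighth power inside. The frequencies [h * b1 v] are distinct, so the
    sum over [v] is at most the complete moment over all [x]. *)
Lemma bilinear_bound (A : {set T1}) (B : {set T2}) h :
  {in A &, injective b1} -> h != 0 ->
  `|\sum_(v in A) \sum_(w in B) psi (h * (b1 v * b2 w))| ^+ 8 <=
    (#|A| ^ 7 * (#|K| * energy 8 B))%:R.
Proof.
move=> b1_inj h0; rewrite natrM natrX -moment8.
set S := fun x => `|\sum_(w in B) psi (x * b2 w)|.
apply: (@le_trans _ _ ((\sum_(v in A) S (h * b1 v)) ^+ 8)).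
  rewrite lerXn2r ?nnegrE ?normr_ge0 //.
    by apply: sumr_ge0 => v _; apply: normr_ge0.
  apply: le_trans (ler_norm_sum _ _ _) _.
  apply: ler_sum => v _; rewrite /S le_eqVlt; apply/orP; left; apply/eqP.
  by under [in RHS]eq_bigr do rewrite -mulrA.
apply: le_trans (pow8_sum_le _ _) _; first by move=> v; apply: normr_ge0.
rewrite ler_wpM2l ?exprn_ge0 //.
have inj : {in A &, injective (fun v => h * b1 v)}.
  by move=> u v Au Av /(mulfI h0)/b1_inj; apply.
rewrite -(big_imset (fun x => S x ^+ 8) inj) /=.
rewrite [X in _ <= X](bigID (mem [set h * b1 v | v in A])) /= lerDl.
by apply: sumr_ge0 => x _; rewrite exprn_ge0 // normr_ge0.
Qed.

(** Counting with the multiplicities of [I + J], instead of an interval, makes each Fourier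
    coefficient a product of two sums, to which Parseval applies without a logarithmic loss. *)
Definition hits a (I J : {set K}) (A : {set T1}) (B : {set T2}) : nat :=
  \sum_(v in A) \sum_(w in B) \sum_(i in I) \sum_(j in J) (i + j == a * (b1 v * b2 w))%R.

(** The frequency 0 gives the main term. At the others, Cauchy-Schwarz and Parseval control the sums
    over [I] and [J], and [bilinear_bound] the double sum. The eighth power keeps roots out of the
    statement. *)
Lemma hits_asymp_C a (I J : {set K}) (A : {set T1}) (B : {set T2}) :
  {in A &, injective b1} -> a != 0 ->
  `|(#|K| * hits a I J A B)%:R - (#|I| * #|J| * #|A| * #|B|)%:R : algC| ^+ 8 <=
  (#|K| ^ 9 * (#|I| * #|J|) ^ 4 * #|A| ^ 7 * energy 8 B)%:R.
Proof.
move=> b1_inj a0.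
pose FI h := \sum_(i in I) psi (h * i); pose FJ h := \sum_(j in J) psi (h * j).
pose FW h := \sum_(v in A) \sum_(w in B) psi (- (h * a) * (b1 v * b2 w)).
have -> : (#|K| * hits a I J A B)%:R = \sum_h FI h * FJ h * FW h.
  rewrite /hits big_distrr /= natr_sum.
  under eq_bigr => v _.
    rewrite big_distrr /= natr_sum; under eq_bigr => w _.
      rewrite big_distrr /= natr_sum; under eq_bigr => i _.
        rewrite big_distrr /= natr_sum; under eq_bigr => j _.
          rewrite -subr_eq0 -sum_character; over.
        rewrite exchange_big /=; over.
      rewrite exchange_big /=; over.
    rewrite exchange_big /=; over.
  rewrite exchange_big /=; apply: eq_bigr => h _.
  rewrite /FW big_distrr /=; apply: eq_bigr => v _.
  rewrite big_distrr /=; apply: eq_bigr => w _.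
  rewrite /FI /FJ big_distrlr /= mulr_suml; apply: eq_bigr => i _.
  rewrite mulr_suml; apply: eq_bigr => j _.
  by rewrite -!psiD; congr (psi _); ring.
rewrite (bigD1 0) //= (_ : _ * _ * FW 0 = (#|I| * #|J| * #|A| * #|B|)%:R); last first.
  rewrite /FI /FJ /FW.
  under eq_bigr do rewrite mul0r psi0.
  under [X in _ * X * _]eq_bigr do rewrite mul0r psi0.
  under [X in _ * _ * X]eq_bigr do under eq_bigr do rewrite mul0r oppr0 mul0r psi0.
  by rewrite !sumr_const -mulrnA -!natrM -!mulnA [(#|B| * _)%N]mulnC.
rewrite addrAC subrr add0r.
set X : algC := (#|A| ^ 7 * (#|K| * energy 8 B))%:R.
have FWle h : h != 0 -> `|FW h| ^+ 8 <= X.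
  move=> h0; apply: bilinear_bound => //; by rewrite oppr_eq0 mulf_neq0.
pose m := (\sum_(h | h != 0) `|FI h| * `|FJ h|).
have m2 : m ^+ 2 <= (#|K| ^ 2 * (#|I| * #|J|))%:R.
  apply: le_trans (cauchy_schwarz _ _ _) _ => [i|i|]; rewrite ?normr_ge0 //.
  have le0 (F : K -> algC) : (forall h, 0 <= F h) -> \sum_(h | h != 0) F h <= \sum_h F h.
    by move=> F0; rewrite [X in _ <= X](bigD1 0) //= lerDr.
  rewrite (_ : (_ ^ 2 * _)%N = (#|K| * #|I|) * (#|K| * #|J|))%N; last by ring.
  rewrite natrM -!parseval_set; apply: ler_pM.
  - by apply: sumr_ge0 => *; rewrite exprn_ge0 ?normr_ge0.
  - by apply: sumr_ge0 => *; rewrite exprn_ge0 ?normr_ge0.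
  - by apply: le0 => *; rewrite exprn_ge0 ?normr_ge0.
  - by apply: le0 => *; rewrite exprn_ge0 ?normr_ge0.
have X0 : 0 <= X by [].
pose r := 8.-root X; have r0 : 0 <= r by rewrite rootC_ge0.
have rX : r ^+ 8 = X by rewrite rootCK.
have FWr h : h != 0 -> `|FW h| <= r.
  by move=> h0; rewrite -(@ler_pXn2r _ 8) ?nnegrE ?normr_ge0 ?rX // FWle.
have m0 : 0 <= m by apply: sumr_ge0 => *; rewrite mulr_ge0 ?normr_ge0.
apply: (@le_trans _ _ ((m * r) ^+ 8)).
  rewrite lerXn2r ?nnegrE ?normr_ge0 ?mulr_ge0 //.
  apply: le_trans (ler_norm_sum _ _ _) _; rewrite mulr_suml.
  by apply: ler_sum => h h0; rewrite !normrM ler_wpM2l ?mulr_ge0 ?normr_ge0 ?FWr.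
rewrite exprMn rX (exprM _ 2 4).
rewrite (_ : (#|K| ^ 9 * _ * _ * _)%N =
  ((#|K| ^ 2 * (#|I| * #|J|)) ^ 4 * (#|A| ^ 7 * (#|K| * energy 8 B)))%N); last by ring.
rewrite natrM ler_wpM2r // [X in _ <= X]natrX.
by rewrite lerXn2r ?nnegrE ?exprn_ge0.
Qed.

End Fourier.

Lemma val_FpD p (x y : 'F_p) : prime p -> nat_of_ord (x + y) = ((x + y)%N %% p)%N.
Proof.
move=> p_pr; have -> : nat_of_ord (x + y) = ((x + y)%N %% (Zp_trunc (pdiv p)).+2)%N by [].
by rewrite [X in (_ %% X)%N]Fp_cast.
Qed.

Lemma exists_character p : prime p -> exists psi : 'F_p -> algC,
  [/\ {morph psi : x y / x + y >-> x * y}, forall x, `|psi x| = 1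
    & exists x, psi x != 1].
Proof.
move=> p_pr; have [z zp] := C_prim_root_exists (prime_gt0 p_pr).
exists (fun x => z ^+ x); split.
- by move=> x y; rewrite val_FpD // (prim_expr_mod zp) exprD.
- move=> x; apply/eqP; rewrite -(@pexpr_eq1 _ _ p) ?normr_ge0 ?prime_gt0 //.
  by rewrite -normrX exprAC (prim_expr_order zp) expr1n normr1.
exists 1; rewrite -(prim_order_dvd zp) /= Fp_cast // modn_small ?prime_gt1 //.
by rewrite dvdn1 neq_ltn prime_gt1 ?orbT.
Qed.

Lemma hits_equidistributed p (T1 T2 : finType) (b1 : T1 -> 'F_p) (b2 : T2 -> 'F_p)
    a (I J : {set 'F_p}) (A : {set T1}) (B : {set T2}) :
  prime p -> {in A &, injective b1} -> a != 0 ->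
  (16 ^ 8 * p ^ 9 * energy b2 8 B <= (#|I| * #|J|) ^ 4 * #|A| * #|B| ^ 8)%N ->
  (15 * (#|I| * #|J| * #|A| * #|B|) <= 16 * (p * hits b1 b2 a I J A B)
    <= 17 * (#|I| * #|J| * #|A| * #|B|))%N.
Proof.
move=> p_pr b1_inj a0 small.
have [psi [psiD psi_norm psi_nt]] := exists_character p_pr.
have := hits_asymp_C psiD psi_norm psi_nt b2 I J B b1_inj a0.
rewrite card_Fp //; set n := hits _ _ _ _ _ _ _; set m := (_ * #|B|)%N => h.
(* A relative error of at most 1/16; its eighth power is the factor [16 ^ 8] of the hypothesis. *)
have {h} : `|(p * n)%:R - m%:R : algC| * 16 <= m%:R.
  rewrite -(@ler_pXn2r _ 8) ?nnegrE ?mulr_ge0 ?normr_ge0 // exprMn.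
  apply: (@le_trans _ _ ((p ^ 9 * (#|I| * #|J|) ^ 4 * #|A| ^ 7 *
                          energy b2 8 B)%:R * 16 ^+ 8)); first by rewrite ler_wpM2r ?exprn_ge0.
  rewrite -!natrX -natrM ler_nat.
  move: small; rewrite /m; move: (energy _ _ _) (16 ^ 8)%N => E c small.
  have := leq_mul small (leqnn ((#|I| * #|J|) ^ 4 * #|A| ^ 7)).
  congr (_ <= _)%N; ring.
case: (leqP m (p * n)) => mn.
  rewrite -natrB // normr_nat -natrM ler_nat; lia.
rewrite distrC -natrB ?(ltnW mn) // normr_nat -natrM ler_nat; lia.
Qed.

Local Open Scope nat_scope.

(** * Reciprocals of primes modulo almost all primes *)

(** The product of the distinct prime divisors divides [n], and each of them is at least 2. *)
Lemma size_primes_log n : 0 < n -> size (primes n) <= trunc_log 2 n.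
Proof.
move=> n0; apply: trunc_log_max => //.
have h (s : seq nat) : uniq s -> all prime s -> all (dvdn^~ n) s ->
    \prod_(q <- s) q %| n /\ 2 ^ size s <= \prod_(q <- s) q.
  elim: s => [_ _ _|q s IH /= /andP[qs us] /andP[q_pr s_pr] /andP[qn sn]].
    by rewrite big_nil dvd1n.
  have [h1 h2] := IH us s_pr sn; rewrite big_cons expnS leq_mul ?prime_gt1 //.
  split=> //; rewrite Gauss_dvd ?qn ?h1 // big_seq.
  elim/big_ind: _ => [|u v qu qv|r rs]; rewrite ?coprimen1 ?coprimeMr ?qu //.
  rewrite prime_coprime // dvdn_prime2 // ?(allP s_pr) //.
  by apply: contraNneq qs => ->.
have [q_pr q_dv] : all prime (primes n) /\ all (dvdn^~ n) (primes n).
  by split; apply/allP => q; rewrite mem_primes => /and3P[].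
have [/dvdn_leq h1 h2] := h _ (primes_uniq n) q_pr q_dv.
exact: leq_trans h2 (h1 n0).
Qed.

(** As each value is taken at least twice, there are at most [k] values. So [f] is a map from
    [2 * k] positions to [k] slots followed by a table of [k] elements of [V]. *)
Lemma card_two_to_one (T : finType) k (V : {set T}) :
  0 < k ->
  #|[set f : {ffun 'I_(2 * k) -> T} | [forall i, f i \in V] &&
      [forall i, exists j, (j != i) && (f j == f i)]]| <= k ^ (2 * k) * #|V| ^ k.
Proof.
move=> k0.
pose E := [set f : {ffun 'I_k -> T} | [forall i, f i \in V]].
have cE : #|E| = #|V| ^ k.
  rewrite -[X in _ ^ X]card_ord -card_ffun_on cardsE; apply: eq_card => f.
  by apply/forallP/ffun_onP.
have cH : #|[set h : {ffun 'I_(2 * k) -> 'I_k} | true]| = k ^ (2 * k).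
  transitivity #|{ffun 'I_(2 * k) -> 'I_k}|; last by rewrite card_ffun !card_ord.
  by apply: eq_card => h; rewrite inE.
rewrite -cE -cH [X in _ <= X]mulnC -cardsX.
pose comp (u : {ffun 'I_k -> T} * {ffun 'I_(2 * k) -> 'I_k}) :=
  [ffun i => u.1 (u.2 i)].
apply: leq_trans (subset_leq_card _) (leq_imset_card comp _).
apply/subsetP => f; rewrite inE => /andP[/forallP fV /forallP f2].
have ltim : #|[set f i | i in 'I_(2 * k)]| <= k.
  rewrite -(@leq_pmul2l 2) // -[X in _ <= X]card_ord.
  rewrite -[X in _ <= X]sum1_card (partition_big_imset f) /= mulnC -sum_nat_const.
  apply: leq_sum => y /imsetP[i _ ->].
  have /existsP[j /andP[ji fj]] := f2 i.
  have {ji} c2 : #|[set i; j]| = 2 by rewrite cards2 eq_sym ji.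
  rewrite sum1dep_card; apply: (@leq_trans #|[set i; j]|); first by rewrite c2.
  apply: subset_leq_card.
  by apply/subsetP => l; rewrite !inE => /orP[] /eqP->; rewrite ?eqxx ?fj.
have i0 : 'I_(2 * k) by exists 0; rewrite muln_gt0.
have ind i : index (f i) (enum [set f i | i in 'I_(2 * k)]) < k.
  apply: leq_trans ltim; rewrite cardE index_mem mem_enum; exact: imset_f.
(* Slots beyond the number of values receive [f i0], which also lies in [V]. *)
apply/imsetP; exists ([ffun j : 'I_k => nth (f i0) (enum [set f i | i in 'I_(2 * k)]) j],
                      [ffun i => Ordinal (ind i)]).
  rewrite !inE andbT; apply/forallP => j; rewrite ffunE.
  case: (ltnP j (size (enum [set f i | i in 'I_(2 * k)]))) => [hj|hj]; last by rewrite nth_default.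
  by have := mem_nth (f i0) hj; rewrite mem_enum => /imsetP[l _ ->].
apply/ffunP => i; rewrite !ffunE /= nth_index // mem_enum; exact: imset_f.
Qed.

Section MeanEnergy.
Variables (D e k : nat).
Hypotheses (e_gt0 : 0 < e) (k_gt0 : 0 < k).
Local Notation T := 'I_D.+1.
Variable V : {set T}.
Hypothesis V_prime : forall v : T, v \in V -> prime v.

(** Used with [e = 1] and [k = 4] for the eighth moment, and with [e = 2] and [k = 2] for the square
    divisors. *)
Definition inv_pow p (v : T) : 'F_p := ((v%:R ^+ e)^-1)%R.

Let numer (f : {ffun 'I_(2 * k) -> T}) : int :=
  (\sum_(i < 2 * k) (-1) ^+ i * (\prod_(j | j != i) (f j) ^ e)%N%:Z)%R.

(** If the prime [f i] occurred only at [i], it would divide every summand except the one at [i],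
    which is up to sign a product of powers of other primes. *)
Lemma numer_eq0 (f : {ffun 'I_(2 * k) -> T}) : (forall i, f i \in V) -> numer f = 0%R ->
  [forall i, exists j, (j != i) && (f j == f i)].
Proof.
move=> fV f0; apply/forallP => i; apply: contraT => /existsPn fi.
have f_pr j := V_prime (fV j).
have : (f i %| `|numer f|)%N by rewrite f0 dvdn0.
rewrite /numer (bigD1 i) //= -[X in X %| _]/(`|Posz (f i)|%N) -dvdzE.
rewrite rpredDr; last first.
  apply: rpred_sum => l li; rewrite dvdz_mull // dvdzE /=.
  by rewrite (bigD1 i) 1?eq_sym //= dvdn_mulr // -{1}(expn1 (f i)) dvdn_exp2l.
rewrite dvdzE abszM abszX /= exp1n mul1n.
elim/big_ind: _ => [|x y hx hy|j ji].
- by rewrite dvdn1 => /eqP fi1; have := f_pr i; rewrite fi1.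
- by rewrite Euclid_dvdM // => /orP[].
rewrite Euclid_dvdX // e_gt0 andbT dvdn_prime2 // => /eqP fij.
by have := fi j; rewrite ji /= -val_eqE /= fij eqxx.
Qed.

(** Multiply the relation by the common denominator of the inverses, whose prime factors are at most
    [D < p]. *)
Lemma dvdn_numer p (f : {ffun 'I_(2 * k) -> T}) : prime p -> D < p -> (forall i, f i \in V) ->
  (\sum_(i < 2 * k) (-1) ^+ i * inv_pow p (f i) = 0)%R -> p %| `|numer f|.
Proof.
move=> p_pr Dp fV f0.
have fn0 i : ((f i)%:R != 0 :> 'F_p)%R.
  rewrite -(dvdn_pcharf (pchar_Fp p_pr)) gtnNdvd ?prime_gt0 ?V_prime //.
  exact: leq_ltn_trans (leq_ord (f i)) Dp.
have : (((numer f)%:~R : 'F_p) = 0)%R.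
  rewrite -[RHS](mulr0 (\prod_j (f j)%:R ^+ e)%R) -f0 mulr_sumr rmorph_sum /=.
  apply: eq_bigr => i _; rewrite rmorphM /= rmorphXn /= rmorphN1 mulrCA; congr (_ * _)%R.
  rewrite [X in _ = (X * _)%R](bigD1 i) //= mulrAC mulfV ?mul1r ?expf_neq0 //.
  rewrite -pmulrn natr_prod; apply: eq_bigr => j _; exact: natrX.
have -> : (((numer f)%:~R : 'F_p) = (-1) ^+ (numer f < 0)%R * (`|numer f|%N)%:R)%R.
  by rewrite {1}[numer f]intEsign rmorphM rmorphXn rmorphN1 /= -pmulrn.
move/eqP; rewrite mulf_eq0 expf_eq0 oppr_eq0 oner_eq0 andbF /=.
by rewrite -(dvdn_pcharf (pchar_Fp p_pr)).
Qed.

Lemma numer_le (f : {ffun 'I_(2 * k) -> T}) : (forall i, f i \in V) ->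
  `|numer f| <= 2 * k * D ^ (e * (2 * k)).
Proof.
move=> fV; rewrite -lez_nat abszE.
apply: le_trans (ler_norm_sum _ _ _) _.
rewrite (_ : 2 * k * _ = \sum_(i < 2 * k) D ^ (e * (2 * k))); last first.
  by rewrite sum_nat_const card_ord.
rewrite -natz natr_sum.
apply: ler_sum => i _; rewrite normrM normrX normrN1 expr1n mul1r natz lez_nat.
have fD j : f j ^ e <= D ^ e by rewrite leq_exp2r // -ltnS ltn_ord.
apply: (@leq_trans (\prod_(j | j != i) D ^ e)); first exact: leq_prod.
rewrite (_ : D ^ (e * (2 * k)) = \prod_(j < 2 * k) D ^ e); last first.
  by rewrite prod_nat_const card_ord expnM.
rewrite [X in _ <= X](bigD1 i) //=.
rewrite leq_pmull // expn_gt0; apply/orP; left.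
apply: leq_trans (prime_gt0 (V_prime (fV i))) _; exact: leq_ord.
Qed.

(* A prime dividing the numerator [numer f] of an alternating sum of inverses
   counts [f] for that prime; the nonzero numerators have few prime divisors,
   and a numerator vanishes only if no value of [f] is taken exactly once. *)
Lemma sum_energy_le (P : seq nat) : uniq P ->
  (forall p, p \in P -> prime p /\ D < p) ->
  \sum_(p <- P) energy (inv_pow p) (2 * k) V <=
    size P * (k ^ (2 * k) * #|V| ^ k) +
    #|V| ^ (2 * k) * trunc_log 2 (2 * k * D ^ (e * (2 * k))).
Proof.
move=> uP PP.
pose W := [set f : {ffun 'I_(2 * k) -> T} | [forall i, f i \in V]].
pose Z := [set f in W | [forall i, exists j, (j != i) && (f j == f i)]].
have cW : #|W| = #|V| ^ (2 * k).
  rewrite -[X in _ ^ X]card_ord -card_ffun_on cardsE; apply: eq_card => f.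
  by apply/forallP/ffun_onP.
have cZ : #|Z| <= k ^ (2 * k) * #|V| ^ k.
  apply: leq_trans (card_two_to_one V k_gt0); apply: subset_leq_card.
  by apply/subsetP => f; rewrite !inE.
apply: (@leq_trans (\sum_(f in W) \sum_(p <- P) (p %| `|numer f|))).
  rewrite exchange_big /= [X in X <= _]big_seq [X in _ <= X]big_seq.
  apply: leq_sum => p /PP[p_pr Dp].
  rewrite /energy -sum1_card big_mkcond /= [X in _ <= X]big_mkcond /=.
  apply: leq_sum => f _; rewrite !inE; case: ifP => //= /andP[fV /eqP f0].
  by rewrite fV (dvdn_numer p_pr Dp) //; apply/forallP.
rewrite (bigID (mem Z)) /=; apply: leq_add.
  apply: (@leq_trans (\sum_(f in Z) size P)).
    rewrite big_mkcond [X in _ <= X]big_mkcond /=; apply: leq_sum => f _.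
    rewrite !inE; case: ifP => // /andP[_ ->].
    rewrite -sum1_size; apply: leq_sum => p _; exact: leq_b1.
  by rewrite sum_nat_const mulnC leq_mul2l cZ orbT.
rewrite -cW -sum_nat_const big_mkcondr; apply: leq_sum => f fW /=.
case: ifP => // fZ; have fV : forall i, f i \in V by move: fW; rewrite inE => /forallP.
have nf0 : 0 < `|numer f|.
  rewrite absz_gt0; apply: contraNneq fZ => /numer_eq0 fZ.
  by rewrite !inE in fW *; rewrite fW fZ.
apply: leq_trans (leq_trunc_log 2 (numer_le fV)).
apply: leq_trans (size_primes_log nf0).
rewrite -big_mkcond /= sum1_count -size_filter; apply: uniq_leq_size.
  exact: filter_uniq.
move=> p; rewrite mem_filter mem_primes => /andP[-> /PP[-> _]].
by rewrite nf0.
Qed.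

End MeanEnergy.

(** * Growth and the number of primes *)

(** With [l] the logarithm and [r = l %/ k.+1], one has [l.+1 <= k.+1 * r.+1] and
    [r.+1 ^ k.+1 <= 2 ^ l]; the spare factor [r.+1] absorbs [c * k.+1 ^ k]. *)
Lemma polylog_le c k : exists x0, forall x, x0 <= x ->
  c * (trunc_log 2 x).+1 ^ k <= x.
Proof.
exists (2 ^ (k.+1 * (c * k.+1 ^ k))) => x hx.
have x_gt0 : 0 < x by apply: leq_trans hx; rewrite expn_gt0.
set l := trunc_log 2 x.
have hl : k.+1 * (c * k.+1 ^ k) <= l by apply: trunc_log_max.
apply: leq_trans (trunc_logP (isT : 1 < 2) x_gt0); rewrite -/l.
set r := l %/ k.+1.
have hr : c * k.+1 ^ k <= r by rewrite leq_divRL // mulnC.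
have l1 : l.+1 <= k.+1 * r.+1 by rewrite mulnC -ltn_divLR.
have h1 : c * l.+1 ^ k <= c * (k.+1 * r.+1) ^ k.
  by rewrite leq_mul2l; case: (k) l1 => [|k'] l1; rewrite ?expn0 ?leq_exp2r ?l1 ?orbT.
apply: leq_trans h1 _; rewrite expnMn mulnA.
apply: (@leq_trans (r.+1 * r.+1 ^ k)); first by rewrite leq_mul2r (leqW hr) orbT.
rewrite -expnS; apply: (@leq_trans ((2 ^ r) ^ k.+1)).
  by rewrite leq_exp2r // ltn_expl.
by rewrite -expnM leq_exp2l // leq_trunc_div.
Qed.

(** By Vandermonde the central coefficient is the sum of ['C(n, i) * 'C(n, n - i)], which dominates
    the sum of the ['C(n, i)]. *)
Lemma exp2_le_central_binomial n : 2 ^ n <= 'C(2 * n, n).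
Proof.
rewrite mul2n -addnn -binomial.Vandermonde -[2]/(1 + 1) expnDn.
apply: leq_sum => i _; rewrite !exp1n !muln1 leq_pmulr // bin_gt0 leq_subr //.
Qed.

(** By Legendre's formula the exponent of [q] is the sum over [k] of [2 * n %/ q ^ k] minus twice
    [n %/ q ^ k]. Each term is at most 1, and 0 once [q ^ k] exceeds [2 * n]. *)
Lemma expn_logn_central_binomial n q : 0 < n -> prime q ->
  q ^ logn q 'C(2 * n, n) <= 2 * n.
Proof.
move=> n_gt0 q_pr; have q1 := prime_gt1 q_pr.
have n2 : 0 < 2 * n by rewrite muln_gt0.
apply: leq_trans (trunc_logP q1 n2); rewrite leq_exp2l //.
have C0 : 0 < 'C(2 * n, n) by rewrite bin_gt0 leq_pmull.
have := congr1 (logn q) (@bin_fact (2 * n) n (leq_pmull n (isT : 0 < 2))).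
rewrite (_ : 2 * n - n = n); last by rewrite mul2n -addnn addnK.
rewrite !lognM ?muln_gt0 ?fact_gt0 // !logn_fact // => hC.
set L := trunc_log q (2 * n).
have Ln : L <= 2 * n.
  apply: leq_trans (trunc_logP q1 n2); apply: ltnW; exact: ltn_expl.
(* Legendre's sums for [n] and [2 * n] are brought to the common length [L]. *)
have wide m : m <= 2 * n ->
    \sum_(1 <= k < m.+1) m %/ q ^ k = \sum_(1 <= k < L.+1) m %/ q ^ k.
  move=> mn; have big a b : a <= b -> m < q ^ a.+1 ->
      \sum_(1 <= k < b.+1) m %/ q ^ k = \sum_(1 <= k < a.+1) m %/ q ^ k.
    move=> ab ma; rewrite (@big_cat_nat _ _ _ a.+1) //= [X in _ + X]big1_seq ?addn0 //.
    move=> k /andP[_]; rewrite mem_index_iota => /andP[ak _]; rewrite divn_small //.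
    by apply: leq_trans ma _; rewrite leq_exp2l.
  have mL : m < q ^ L.+1 by apply: leq_ltn_trans mn (trunc_log_ltn _ q1).
  have mm : m < q ^ m.+1 by apply: leq_trans (ltn_expl m q1) _; rewrite leq_exp2l.
  have [mleL|/ltnW Llem] := leqP m L; last exact: big.
  by rewrite (big m L).
move: hC; rewrite !wide ?leq_pmull // => hC.
suff : \sum_(1 <= k < L.+1) 2 * n %/ q ^ k <=
    \sum_(1 <= k < L.+1) (1 + (n %/ q ^ k + n %/ q ^ k)).
  by rewrite 2!big_split /= sum_nat_const_nat; lia.
apply: leq_sum => k _; rewrite -ltnS ltn_divLR ?expn_gt0 ?prime_gt0 //.
have := ltn_ceil n (_ : 0 < q ^ k); rewrite expn_gt0 prime_gt0 // => /(_ isT); lia.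
Qed.

(** Chebyshev's argument: the central binomial coefficient is a product of prime powers, each at
    most [2 * n], over primes up to [2 * n]. *)
Lemma exp2_le_expn_prime_count n : 0 < n ->
  2 ^ n <= (2 * n) ^ #|[set q : 'I_(2 * n).+1 | prime q]|.
Proof.
move=> n_gt0; apply: leq_trans (exp2_le_central_binomial n) _.
have C0 : 0 < 'C(2 * n, n) by rewrite bin_gt0 leq_pmull.
rewrite -[X in X <= _](partnT C0) /partn.
have log0 q : (2 * n < q) || ~~ prime q || ('C(2 * n, n) < q) ->
    logn q 'C(2 * n, n) = 0.
  rewrite lognE; case: ifP => // /and3P[q_pr _ qC].
  rewrite q_pr orbF ltnNge [_ < q]ltnNge (dvdn_leq C0 qC) orbF => /negP[].
  have := expn_logn_central_binomial n_gt0 q_pr; apply: leq_trans.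
  rewrite -[X in X <= _]expn1 leq_exp2l ?prime_gt1 //.
  by rewrite -pfactor_dvdn // expn1.
have cut a b : a <= b -> (forall q, a <= q -> logn q 'C(2 * n, n) = 0) ->
    \prod_(0 <= q < b) q ^ logn q 'C(2 * n, n) =
    \prod_(0 <= q < a) q ^ logn q 'C(2 * n, n).
  move=> ab h; rewrite (@big_cat_nat _ _ _ a) //= [X in _ * X]big1_seq ?muln1 //.
  by move=> q /andP[_]; rewrite mem_index_iota => /andP[aq _]; rewrite h.
set B := 'C(2 * n, n) in log0 cut *.
rewrite -(cut B.+1 (B + (2 * n)).+1) ?ltnS ?leq_addr //; last first.
  by move=> q Bq; apply: log0; rewrite Bq !orbT.
rewrite (cut (2 * n).+1) ?ltnS ?leq_addl //; last first.
  by move=> q nq; apply: log0; rewrite nq.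
rewrite big_mkord -prod_nat_const [X in _ <= X]big_mkcond /=.
apply: leq_prod => q _; rewrite inE; case: ifPn => q_pr.
  exact: expn_logn_central_binomial.
by rewrite log0 // q_pr orbT.
Qed.

(** The logarithm lost in Chebyshev's bound is absorbed by one factor [x]. *)
Lemma prime_count_pow_ge x j : 0 < j -> 2 <= x ->
  4 * (j * (trunc_log 2 x).+1).+1 <= x ->
  x ^ j.-1 <= #|[set q : 'I_(x ^ j).+1 | prime q]|.
Proof.
move=> j0 x2 hx; set c := #|_|; set l := (trunc_log 2 x).+1 in hx *.
have xj : 2 <= x ^ j.
  by apply: (leq_trans x2); rewrite -[X in X <= _]expn1 leq_exp2l.
pose n := x ^ j %/ 2.
have n0 : 0 < n by rewrite divn_gt0.
have n2 : 2 * n <= x ^ j by rewrite mulnC leq_trunc_div.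
have cn : #|[set q : 'I_(2 * n).+1 | prime q]| <= c.
  rewrite /c -!sum1dep_card -!(big_mkord (fun q => prime q) (fun=> 1)).
  by rewrite [X in _ <= X](@big_cat_nat _ _ _ (2 * n).+1) //= leq_addr.
have xl : x ^ j <= 2 ^ (j * l).
  by rewrite mulnC expnM leq_exp2r // ltnW // trunc_log_ltn.
have : 2 ^ n <= 2 ^ (j * l * c).
  apply: leq_trans (exp2_le_expn_prime_count n0) _; rewrite [in X in _ <= X]expnM.
  apply: (@leq_trans ((2 ^ (j * l)) ^ #|[set q : 'I_(2 * n).+1 | prime q]|)).
    case: (#|_|) => // m; rewrite leq_exp2r //; exact: leq_trans n2 xl.
  by rewrite leq_exp2l ?cn // (leq_trans xj).
rewrite leq_exp2l // => nle.
have x4 : x ^ j <= 4 * n by rewrite /n; lia.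
have : x * x ^ j.-1 <= x * c.
  rewrite -expnS prednK //; apply: leq_trans x4 _.
  apply: (@leq_trans (4 * (j * l * c))); first by rewrite leq_mul2l nle orbT.
  rewrite mulnA leq_mul2r; apply/orP; right; apply: leq_trans hx.
  by rewrite leq_mul2l leqnSn orbT.
by rewrite leq_pmul2l // (leq_trans _ x2).
Qed.

(** * Equidistribution in intervals *)

Lemma val_Fp_lt p (x : 'F_p) : prime p -> x < p.
Proof. by move=> p_pr; rewrite -[X in _ < X](Fp_cast p_pr) ltn_ord. Qed.

Lemma card_Fp_lt p m : prime p -> m <= p -> #|[set x : 'F_p | x < m]| = m.
Proof.
move=> p_pr mp; rewrite -sum1dep_card -(big_ord_widen _ (fun=> 1)) ?Fp_cast //.
by rewrite sum1_card card_ord.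
Qed.

Definition pos_le p m (x : 'F_p) := 0 < x <= m.

Lemma card_Fp_pos_le p m : prime p -> m < p ->
  #|[set x : 'F_p | pos_le m x]| = m.
Proof.
move=> p_pr mp; have := card_Fp_lt p_pr mp.
rewrite (cardsD1 0%R) inE /= => -[h]; rewrite -[RHS]h; apply: eq_card => x.
by rewrite !inE /pos_le lt0n ltnS.
Qed.

Section Intervals.
Variables (p : nat) (T1 T2 : finType) (b1 : T1 -> 'F_p) (b2 : T2 -> 'F_p).
Variables (A : {set T1}) (B : {set T2}).
Hypotheses (p_pr : prime p) (b1_inj : {in A &, injective b1}).

Definition small_pairs a U : nat :=
  \sum_(v in A) \sum_(w in B) pos_le U (a * (b1 v * b2 w))%R.

(** An element of [1..c] plus one of [0..U - c] lies in [1..U], and a residue is such a sum in at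
    most [c] ways. *)
Lemma hits_le_small_pairs a U c : c <= U -> U < p ->
  hits b1 b2 a [set x : 'F_p | pos_le c x] [set x : 'F_p | x < (U - c).+1] A B <=
    c * small_pairs a U.
Proof.
move=> cU Up; rewrite /hits /small_pairs big_distrr; apply: leq_sum => v _ /=.
rewrite big_distrr; apply: leq_sum => w _ /=.
move: (a * _)%R => y.
rewrite -[X in X * _](card_Fp_pos_le p_pr (leq_ltn_trans cU Up)) -sum_nat_const.
apply: leq_sum => i; rewrite inE => /andP[i0 ic].
case: (boolP (pos_le U y)) => [_|yU].
  rewrite big_mkcond /= (bigD1 (y - i)%R) //= big1 ?addn0 => [|j ji].
    by case: ifP => // _; exact: leq_b1.
  case: ifP => // _; apply/eqP; rewrite eqb0; apply: contraNneq ji => <-.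
  by rewrite addrC addKr.
rewrite big1 // => j; rewrite inE => jU; apply/eqP; rewrite eqb0.
apply: contraNneq yU => <-; rewrite /pos_le val_FpD // modn_small; lia.
Qed.

(** The second set is now the interval from [1 - c] to [U - 1], written as a translate, so that each
    element of [1..U] is a sum in [c] ways. *)
Lemma small_pairs_le_hits a U c : 0 < c -> U + c.-1 < p ->
  c * small_pairs a U <=
  hits b1 b2 a [set x : 'F_p | pos_le c x]
    [set x : 'F_p | pos_le (U + c.-1) (x + c%:R)%R] A B.
Proof.
move=> c0 Up; rewrite /hits /small_pairs big_distrr; apply: leq_sum => v _ /=.
rewrite big_distrr; apply: leq_sum => w _ /=.
move: (a * _)%R => y; case: (boolP (pos_le U y)) => [/andP[y0 yU]|_]; last first.
  by rewrite muln0.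
have cp : c < p by lia.
rewrite -[X in X * _](card_Fp_pos_le p_pr cp) -sum_nat_const.
apply: leq_sum => i; rewrite inE => /andP[i0 ic].
rewrite (bigD1 (y - i)%R) /=; first by rewrite addrC subrK eqxx.
rewrite inE; have -> : (y - i + c%:R = (y + (c - i))%N%:R)%R.
  by rewrite natrD natrB // !natr_Zp addrA addrAC.
rewrite /pos_le val_Fp_nat // modn_small; lia.
Qed.

Variable a : 'F_p.
Hypothesis a0 : a != 0%R.
Variable U : nat.
Hypothesis U16 : 16 <= U.
Hypothesis Up : U * 2 <= p.
Hypothesis small : 2 ^ 56 * p ^ 9 * energy b2 8 B <= U ^ 8 * #|A| * #|B| ^ 8.

Let energy_small (I J : {set 'F_p}) : U ^ 2 <= 64 * (#|I| * #|J|) ->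
  16 ^ 8 * p ^ 9 * energy b2 8 B <= (#|I| * #|J|) ^ 4 * #|A| * #|B| ^ 8.
Proof.
move=> UIJ; have h : U ^ 8 <= 64 ^ 4 * (#|I| * #|J|) ^ 4.
  by rewrite -expnMn (expnM _ 2 4) leq_exp2r.
(* [16 ^ 8] comes from the relative error 1/16, and [64 ^ 4] from the factor 64 between [U ^ 2] and
   the product of the two lengths. *)
have e56 : 2 ^ 56 = 64 ^ 4 * 16 ^ 8.
  rewrite -[64]/(2 ^ 6) -[16]/(2 ^ 4) -!expnM -expnD; exact: (congr1 (expn 2)).
have c0 : 0 < 64 ^ 4 by rewrite expn_gt0.
move: small h c0; rewrite e56; move: (64 ^ 4) (16 ^ 8) => d c hs h d0.
have : d * (c * p ^ 9 * energy b2 8 B) <=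
    d * ((#|I| * #|J|) ^ 4 * #|A| * #|B| ^ 8).
  apply: (@leq_trans (U ^ 8 * #|A| * #|B| ^ 8)).
    by rewrite (mulnA d) (mulnA d).
  move: h; move: (U ^ 8) ((#|I| * #|J|) ^ 4) (#|B| ^ 8) => u ij b h.
  by rewrite !mulnA !leq_mul.
by rewrite leq_pmul2l.
Qed.

(** The constant is [225 / 256 = (15 / 16) ^ 2]: one factor is the error of equidistribution, the
    other comes from shortening the interval by [c = U %/ 16]. The upper bound has
    [(17 / 16) ^ 2 = 289 / 256] likewise. *)
Lemma small_pairs_lower : 225 * U * #|A| * #|B| <= 256 * p * small_pairs a U.
Proof.
set c := U %/ 16; have cU : c <= U by rewrite leq_div.
have Up1 : U < p by lia.
have := hits_le_small_pairs a cU Up1.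
set I := [set x | _]; set J := [set x | _] => hle.
have cI : #|I| = c by rewrite card_Fp_pos_le //; lia.
have cJ : #|J| = (U - c).+1 by rewrite card_Fp_lt //; lia.
have UIJ : U ^ 2 <= 64 * (#|I| * #|J|).
  have cc : U <= 32 * c by lia.
  rewrite cI cJ (_ : 64 * _ = (32 * c) * (2 * (U - c).+1)); last by ring.
  by apply: leq_mul => //; lia.
have /andP[h _] := hits_equidistributed p_pr b1_inj a0 (energy_small UIJ).
rewrite cI cJ in h.
have : c * (15 * ((U - c).+1 * #|A| * #|B|)) <= c * (16 * (p * small_pairs a U)).
  move: h; set s := small_pairs a U; move: (hits _ _ _ _ _ _ _) hle => t hle h.
  have : 15 * (c * (U - c).+1 * #|A| * #|B|) <= 16 * (p * (c * s)).
    by apply: leq_trans h _; rewrite !leq_mul2l hle !orbT.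
  by congr (_ <= _)%N; ring.
rewrite leq_pmul2l ?divn_gt0 // => {}h.
have : 16 * (15 * ((U - c).+1 * #|A| * #|B|)) <= 16 * (16 * (p * small_pairs a U)).
  by rewrite leq_mul2l h orbT.
rewrite (_ : 16 * (16 * _) = 256 * p * small_pairs a U); last by ring.
apply: leq_trans.
rewrite (_ : 16 * _ = 15 * (16 * (U - c).+1) * #|A| * #|B|); last by ring.
by apply: leq_mul => //; apply: leq_mul => //; lia.
Qed.

Lemma small_pairs_upper : 256 * p * small_pairs a U <= 289 * U * #|A| * #|B|.
Proof.
set c := U %/ 16; have c0 : 0 < c by rewrite divn_gt0.
have Up1 : U + c.-1 < p by lia.
have := small_pairs_le_hits a c0 Up1.
set I := [set x | _]; set J := [set x | _] => hle.
have cI : #|I| = c by rewrite card_Fp_pos_le //; lia.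
have cJ : #|J| = U + c.-1.
  rewrite -[RHS](card_Fp_pos_le p_pr Up1) -(card_imset _ (addIr (c%:R : 'F_p)%R)).
  apply: eq_card => x; apply/imsetP/idP => [[y + ->]|]; first by rewrite !inE.
  by rewrite inE => hx; exists (x - c%:R)%R; rewrite ?inE subrK.
have UIJ : U ^ 2 <= 64 * (#|I| * #|J|).
  have cc : U <= 32 * c by lia.
  rewrite cI cJ (_ : 64 * _ = (32 * c) * (2 * (U + c.-1))); last by ring.
  by apply: leq_mul => //; lia.
have /andP[_ h] := hits_equidistributed p_pr b1_inj a0 (energy_small UIJ).
rewrite cI cJ in h.
have : c * (16 * (p * small_pairs a U)) <= c * (17 * ((U + c.-1) * #|A| * #|B|)).
  move: h; set s := small_pairs a U; move: (hits _ _ _ _ _ _ _) hle => t hle h.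
  have : 16 * (p * (c * s)) <= 17 * (c * (U + c.-1) * #|A| * #|B|).
    by apply: leq_trans h; rewrite !leq_mul2l hle !orbT.
  by congr (_ <= _)%N; ring.
rewrite leq_pmul2l // => {}h.
have : 16 * (16 * (p * small_pairs a U)) <= 16 * (17 * ((U + c.-1) * #|A| * #|B|)).
  by rewrite leq_mul2l h orbT.
rewrite (_ : 16 * (16 * _) = 256 * p * small_pairs a U); last by ring.
move/leq_trans; apply.
rewrite (_ : 16 * _ = 17 * (16 * (U + c.-1)) * #|A| * #|B|); last by ring.
by apply: leq_mul => //; apply: leq_mul => //; lia.
Qed.

End Intervals.

(** * Multiples of squares in a residue class *)

Definition primes_between lo D : {set 'I_D.+1} := [set v : 'I_D.+1 | prime v && (lo < v)].

Definition square_multiples p (a : 'F_p) N (P : pred nat) : {set 'I_N.+1} :=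
  [set n : 'I_N.+1 | (n%:R == a)%R &&
           [exists q : 'I_N.+1, [&& prime q, P q & q ^ 2 %| n]]].

Lemma card_progression N m (S : {set 'I_N.+1}) : 0 < m ->
  {in S &, forall n n' : 'I_N.+1, n = n' %[mod m]} -> #|S| <= (N %/ m).+1.
Proof.
move=> m0 Sm.
have qN (n : 'I_N.+1) : n %/ m < (N %/ m).+1 by rewrite ltnS leq_div2r // -ltnS.
rewrite -[X in _ <= X]card_ord.
rewrite -(card_in_imset (f := fun n : 'I_N.+1 => Ordinal (qN n))) ?max_card //.
move=> n n' Sn Sn' [h]; apply/val_inj.
by rewrite /= (divn_eq n m) (divn_eq n' m) h (Sm n n').
Qed.

Lemma eq_Fp_mod p n n' : prime p -> (n%:R = n'%:R :> 'F_p)%R -> n = n' %[mod p].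
Proof. by move=> p_pr /(congr1 val); rewrite /= !val_Fp_nat. Qed.

Lemma card_bigcup_le (I T : finType) (P : pred I) (F : I -> {set T}) :
  #|\bigcup_(i | P i) F i| <= \sum_(i | P i) #|F i|.
Proof.
elim/big_rec2: _ => [|i n X _ IH]; first by rewrite cards0.
by apply: leq_trans (leq_card_setU _ _) _; rewrite leq_add2l.
Qed.

Section Bad.
Variables (p : nat) (a : 'F_p) (N : nat).
Hypotheses (p_pr : prime p) (a0 : a != 0%R).

Lemma card_square_class q : prime q -> q < p ->
  #|[set n : 'I_N.+1 | (n%:R == a)%R && (q ^ 2 %| n)]| <= (N %/ (q ^ 2 * p)).+1.
Proof.
move=> q_pr qp; apply: card_progression.
  by rewrite muln_gt0 expn_gt0 !prime_gt0.
move=> n n'; rewrite !inE => /andP[/eqP na qn] /andP[/eqP n'a qn'].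
apply/eqP; rewrite chinese_remainder; last first.
  rewrite coprimeXl // prime_coprime // dvdn_prime2 //.
  by rewrite neq_ltn qp.
rewrite [n == _ %[mod p]](introT eqP (eq_Fp_mod p_pr _)) ?na ?n'a // andbT.
by rewrite (eqP qn) (eqP qn').
Qed.

Definition square_moduli lo D : {set 'I_D.+1} :=
  [set q : 'I_D.+1 in primes_between lo D |
     [exists n : 'I_N.+1, (n%:R == a)%R && (q ^ 2 %| n)]].

(** Each occurring [q] contributes one progression modulo [q ^ 2 * p], whose length is bounded
    uniformly by [q > lo]. *)
Lemma card_square_multiples lo D : 0 < lo -> D < p ->
  #|square_multiples a N (fun q => lo < q <= D)| <=
    #|square_moduli lo D| * (N %/ (lo ^ 2 * p)).+1.
Proof.
move=> lo0 Dp; rewrite -sum_nat_const.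
apply: (@leq_trans (\sum_(q in square_moduli lo D)
    #|[set n : 'I_N.+1 | (n%:R == a)%R && (q ^ 2 %| n)]|)); last first.
  apply: leq_sum => q; rewrite !inE => /andP[/andP[q_pr lq] _].
  apply: leq_trans (card_square_class q_pr _) _.
    exact: leq_ltn_trans (leq_ord q) Dp.
  rewrite ltnS leq_div2l ?muln_gt0 ?expn_gt0 ?lo0 ?prime_gt0 //.
  by rewrite leq_mul2r leq_exp2r // ltnW ?orbT.
apply: leq_trans (subset_leq_card _) (card_bigcup_le _ _).
apply/subsetP => n; rewrite inE => /andP[na /existsP[q /and3P[q_pr /andP[lq qD] qn]]].
have qD1 : q < D.+1 by [].
apply/bigcupP; exists (Ordinal qD1); last by rewrite inE na.
by rewrite !inE q_pr lq; apply/existsP; exists n; rewrite na.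
Qed.

(* If [q1^-2 + q2^-2 = q3^-2 + q4^-2] up to the factor [a], both sides are
   reductions of integers at most [2 * (N %/ lo ^ 2)], so that few values are
   taken and Cauchy-Schwarz turns the bound for collisions into one for [q]. *)
Lemma card_square_moduli lo D : 0 < lo -> D < p ->
  #|square_moduli lo D| ^ 4 <=
    (2 * (N %/ lo ^ 2)).+1 * energy (@inv_pow D 2 p) 4 (primes_between lo D).
Proof.
move=> lo0 Dp; set R := square_moduli lo D; set m := N %/ lo ^ 2.
pose b := @inv_pow D 2 p.
have Rq q : q \in R -> [/\ prime q, lo < q & (q%:R != 0 :> 'F_p)%R].
  rewrite !inE => /andP[/andP[q_pr lq] _]; split=> //.
  rewrite -(dvdn_pcharf (pchar_Fp p_pr)) gtnNdvd ?prime_gt0 //.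
  exact: leq_ltn_trans (leq_ord q) Dp.
pose F (u : 'I_D.+1 * 'I_D.+1) := (a * (b u.1 + b u.2))%R.
pose r y := \sum_(u in setX R R) (F u == y).
pose Y := [set (i%:R : 'F_p)%R | i : 'I_(2 * m).+1].
have FY u : u \in setX R R -> F u \in Y.
  have h q : q \in R -> exists2 i, i <= m & (a * b q = i%:R)%R.
    move=> qR; have [q_pr lq q0] := Rq _ qR.
    move: qR; rewrite inE => /andP[_ /existsP[n /andP[/eqP <- qn]]].
    exists (n %/ q ^ 2).
      apply: (@leq_trans (N %/ q ^ 2)); first by rewrite leq_div2r // -ltnS.
      by rewrite leq_div2l ?expn_gt0 ?lo0 // leq_exp2r // ltnW.
    rewrite -{1}(divnK qn) natrM natrX /b /inv_pow mulfK // expf_neq0 //.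
  case: u => q1 q2; rewrite in_setX /= => /andP[/h[i1 hi1 e1] /h[i2 hi2 e2]].
  have hi : i1 + i2 < (2 * m).+1 by rewrite mul2n -addnn ltnS leq_add.
  by apply/imsetP; exists (Ordinal hi); rewrite // /F mulrDr e1 e2 -natrD.
have RR : #|R| ^ 2 = \sum_(y in Y) r y.
  rewrite /r exchange_big /= -mulnn -cardsX -sum1_card; apply: eq_bigr => u uR.
  rewrite (bigD1 (F u)) ?FY //= eqxx big1 // => y /andP[_].
  by rewrite eq_sym => /negbTE ->.
have CS : (\sum_(y in Y) r y) ^ 2 <= #|Y| * \sum_(y in Y) r y ^ 2.
  rewrite -(ler_nat int) natrX natrM !natr_sum.
  under [X in (_ <= _ * X)%R]eq_bigr do rewrite natrX.
  exact: sqr_sum_le.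
rewrite (expnM _ 2 2) RR; apply: leq_trans CS _; apply: leq_mul.
  by apply: leq_trans (leq_imset_card _ _) _; rewrite card_ord.
apply: (@leq_trans (\sum_(u in setX R R) \sum_(v in setX R R) (F u == F v))).
  under eq_bigr do rewrite -mulnn big_distrlr /=.
  rewrite exchange_big /=; apply: leq_sum => u uR.
  rewrite exchange_big /=; apply: leq_sum => v vR.
  rewrite (bigD1 (F u)) ?FY //= eqxx mul1n [F v == _]eq_sym big1 ?addn0 // => y.
  by case/andP=> _; rewrite eq_sym => /negbTE->.
(* The two pairs are interleaved so that the signs of [energy], which alternate, put them on
   opposite sides. *)
pose f (w : ('I_D.+1 * 'I_D.+1) * ('I_D.+1 * 'I_D.+1)) : {ffun 'I_4 -> 'I_D.+1} :=
  [ffun i : 'I_4 => nth w.1.1 [:: w.1.1; w.2.1; w.1.2; w.2.2] i].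
pose S := [set w | [&& w.1 \in setX R R, w.2 \in setX R R & F w.1 == F w.2]].
have f_inj : injective f.
  move=> [[w1 w2] [w3 w4]] [[v1 v2] [v3 v4]] /ffunP h.
  have := h (@Ordinal 4 0 isT); have := h (@Ordinal 4 1 isT).
  have := h (@Ordinal 4 2 isT); have := h (@Ordinal 4 3 isT).
  by rewrite !ffunE /= => -> -> -> ->.
rewrite pair_big_dep /=.
apply: (@leq_trans #|S|).
  rewrite -sum1_card big_mkcond [X in _ <= X]big_mkcond /=; apply: leq_sum => w _.
  rewrite !inE; case: (F _ == _); rewrite ?andbT ?andbF //.
  by case: ifP.
rewrite -(card_imset _ f_inj); apply: subset_leq_card.
apply/subsetP => g /imsetP[[[q1 q2] [q3 q4]]].
rewrite [_ \in S]inE /= !in_setX => /and3P[/andP[q1R q2R] /andP[q3R q4R] /eqP Fw] ->.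
have RB q : q \in R -> q \in primes_between lo D by rewrite [q \in R]inE => /andP[].
rewrite inE; apply/andP; split.
  apply/forallP => -[[|[|[|[|//]]]] hi]; rewrite ffunE /=; exact: RB.
rewrite !big_ord_recl big_ord0 !ffunE /= /bump /= !addn0 -/b.
rewrite expr0 expr1 !exprS !expr0 mulr1 !mulN1r opprK !mul1r addr0.
have /= h := mulfI a0 Fw; rewrite -/b in h *.
apply/eqP; rewrite -[RHS](subrr (b q3 + b q4)%R) -{1}h; ring.
Qed.

(* For given [m], the congruence [q ^ 2 * m = a] has at most one solution [q]
   in each half of [0, p[. *)
Lemma card_square_multiples_large lo : 0 < lo -> N < p ^ 2 ->
  #|square_multiples a N (fun q => lo < q)| <= 2 * (N %/ lo ^ 2).+1.
Proof.
move=> lo0 Np; set S := square_multiples _ _ _.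
pose Pq (n q : 'I_N.+1) := [&& prime q, lo < q & q ^ 2 %| n].
pose q (n : 'I_N.+1) : 'I_N.+1 := odflt n [pick q | Pq n q].
have qP n : n \in S -> Pq n (q n).
  rewrite inE => /andP[_ /existsP[r hr]]; rewrite /q.
  by case: pickP => [//|/(_ r)]; rewrite /Pq hr.
have nle n : n \in S -> n %/ q n ^ 2 < (N %/ lo ^ 2).+1.
  move=> /qP /and3P[_ lq _]; rewrite ltnS.
  apply: (@leq_trans (N %/ q n ^ 2)); first by rewrite leq_div2r // -ltnS.
  by rewrite leq_div2l ?expn_gt0 ?lo0 // leq_exp2r // ltnW.
pose g (n : 'I_N.+1) : bool * 'I_(N %/ lo ^ 2).+1 :=
  (q n * 2 < p, inord (n %/ q n ^ 2)).
have g_inj : {in S &, injective g}.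
  move=> n n' nS n'S [hs /(congr1 val)]; rewrite /= !inordK ?nle // => hm.
  have /and3P[q_pr lq qn] := qP _ nS; have /and3P[q'_pr lq' qn'] := qP _ n'S.
  move: (nS) (n'S); rewrite !inE => /andP[/eqP na _] /andP[/eqP n'a _].
  move: q_pr lq qn q'_pr lq' qn' hs hm.
  set r := (q n : nat); set r' := (q n' : nat); move=> r_pr lr rn r'_pr lr' rn' hs hm.
  have n0 (k : 'I_N.+1) : (k%:R = a)%R -> 0 < k.
    by move=> ka; rewrite lt0n; apply: contraNneq a0 => k0; rewrite -ka k0.
  have rp (k : 'I_N.+1) t : 0 < k -> t ^ 2 %| k -> t < p.
    move=> k0 /(dvdn_leq k0) tk; rewrite -(@ltn_exp2r _ _ 2) //.
    by apply: leq_ltn_trans Np; apply: leq_trans tk _; rewrite -ltnS.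
  have rlt := rp _ _ (n0 _ na) rn; have r'lt := rp _ _ (n0 _ n'a) rn'.
  have sq : ((r%:R ^+ 2 = r'%:R ^+ 2 :> 'F_p))%R.
    have m0 : ((n %/ r ^ 2)%:R != 0 :> 'F_p)%R.
      apply: contraNneq a0 => m0.
      by rewrite -na -(divnK rn) natrM m0 mul0r.
    apply: (mulfI m0); rewrite -!natrX -!natrM {2}hm !divnK //.
    by rewrite na n'a.
  suff rr : r = r'.
    by apply/val_inj; rewrite /= -[LHS](divnK rn) -[RHS](divnK rn') hm rr.
  move/eqP: sq; rewrite eqf_sqr => /orP[/eqP /(eq_Fp_mod p_pr)|].
    by rewrite !modn_small.
  rewrite -addr_eq0 -natrD -(dvdn_pcharf (pchar_Fp p_pr)) => pr.
  have ple : p <= r + r' by apply: dvdn_leq pr; rewrite addn_gt0 prime_gt0.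
  have {}pr : r + r' = p.
    have /eqP : (r + r') %% p == 0 by [].
    rewrite -{1}(subnK ple) modnDr modn_small; clear -ple rlt r'lt; lia.
  by move: hs; case: (ltnP (r * 2) p); case: (ltnP (r' * 2) p); clear -pr; lia.
rewrite -(card_in_imset g_inj); apply: leq_trans (max_card _) _.
by rewrite card_prod card_bool card_ord.
Qed.
End Bad.

(** * Candidates without small square divisors *)

(** The prime 2 gives 1/4. An odd [q = 2 * m + 1] gives at most [1 / (4 * m * (m + 1))], which
    telescopes to less than another 1/4. *)
Lemma sum_inv_prime_squares n : 0 < n ->
  (\sum_(q < n.*2.+1 | prime q) (q%:R ^+ 2)^-1 <= 2%:R^-1 - (n%:R *+ 4)^-1 :> rat)%R.
Proof.
case: n => // n _; elim: n => [|n IH].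
  rewrite big_mkcond !big_ord_recr big_ord0 /= !add0r.
  by rewrite -natrX -[(1.*2 ^ 2)%N]/4%N; lra.
rewrite doubleS big_mkcond 2!big_ord_recr -big_mkcond /=.
rewrite [X in (_ + X)%R]ifN; last first.
  by apply/negP => /even_prime[]; lia.
rewrite addr0; apply: le_trans (lerD IH (lexx _)) _.
have -> : (2%:R^-1 - (n.+2%:R *+ 4)^-1 : rat)%R =
   (2%:R^-1 - (n.+1%:R *+ 4)^-1 + (n.+1%:R * n.+2%:R *+ 4)^-1)%R.
  by rewrite -[n.+2%:R%R]natr1; field; rewrite !nat1r natr1 !pnatr_eq0.
rewrite lerD2l; case: ifP => _; last first.
  by rewrite invr_ge0 mulrn_wge0 // mulr_ge0.
rewrite lef_pV2 ?posrE ?pmulrn_lgt0 ?exprn_gt0 ?mulr_gt0 ?ltr0n //.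
by rewrite -natrM -mulrnA -natrX ler_nat; lia.
Qed.

Lemma sum_div_prime_squares U D :
  2 * \sum_(q < D.+1 | prime q) U %/ q ^ 2 <= U.
Proof.
have le_inv q : prime q -> ((U %/ q ^ 2)%:R <= U%:R * (q%:R ^+ 2)^-1 :> rat)%R.
  move=> q_pr; rewrite ler_pdivlMr ?exprn_gt0 ?ltr0n ?prime_gt0 //.
  by rewrite -natrX -natrM ler_nat leq_trunc_div.
rewrite -(ler_nat rat) natrM natr_sum.
apply: (@le_trans _ _ (2%:R * (U%:R * 2%:R^-1))%R); last by rewrite mulrC divfK.
rewrite ler_pM2l //; apply: le_trans (ler_sum _ _) _; first by move=> q; exact: le_inv.
rewrite -mulr_sumr ler_wpM2l //.
apply: (@le_trans _ _ (\sum_(q < D.+1.*2.+1 | prime q) (q%:R ^+ 2)^-1)%R).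
  rewrite -!(big_mkord (fun q => prime q) (fun q => (q%:R ^+ 2)^-1 : rat)%R).
  rewrite [X in (_ <= X)%R](@big_cat_nat _ _ _ D.+1) //=; last by lia.
  by rewrite lerDl sumr_ge0 // => q _; rewrite invr_ge0 exprn_ge0.
apply: le_trans (sum_inv_prime_squares _) _ => //.
by rewrite gerBl invr_ge0 mulrn_wge0.
Qed.

Section Pairs.
Variables (p lo DA DB : nat).
Hypotheses (p_pr : prime p) (lo_p : lo < p) (DA_p : DA < p) (DB_p : DB < p).
Local Notation A := (primes_between lo DA).
Local Notation B := (primes_between lo DB).
Local Notation b1 := (@inv_pow DA 1 p).
Local Notation b2 := (@inv_pow DB 1 p).

Lemma prime_Fp_neq0 q : prime q -> q < p -> (q%:R != 0 :> 'F_p)%R.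
Proof.
by move=> q_pr qp; rewrite -(dvdn_pcharf (pchar_Fp p_pr)) gtnNdvd ?prime_gt0.
Qed.

Definition squarefree_upto (u : 'F_p) := [forall q : 'I_lo.+1, prime q ==> ~~ (q ^ 2 %| u)].

Definition good_pairs (a : 'F_p) U : {set 'I_DA.+1 * 'I_DB.+1} :=
  [set v in setX A B | pos_le U (a * (b1 v.1 * b2 v.2))%R &&
                       squarefree_upto (a * (b1 v.1 * b2 v.2))%R].

(** If [q ^ 2] divides a representative [y <= U], then [y %/ q ^ 2] represents the same pair for
    [a / q ^ 2] and is at most [U %/ q ^ 2]. *)
Lemma small_pairs_le_good (a : 'F_p) U :
  small_pairs b1 b2 A B a U <= #|good_pairs a U| +
    \sum_(q < lo.+1 | prime q) small_pairs b1 b2 A B (a / q%:R ^+ 2)%R (U %/ q ^ 2).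
Proof.
have pairE (f : 'I_DA.+1 -> 'I_DB.+1 -> nat) :
    \sum_(v in A) \sum_(w in B) f v w = \sum_(u in setX A B) f u.1 u.2.
  by rewrite pair_big_dep; apply: eq_bigl => -[v w]; rewrite in_setX.
have -> : #|good_pairs a U| = \sum_(u in setX A B)
    (pos_le U (a * (b1 u.1 * b2 u.2))%R && squarefree_upto (a * (b1 u.1 * b2 u.2))%R).
  rewrite -sum1_card big_mkcond [RHS]big_mkcond; apply: eq_bigr => u _.
  rewrite [u \in good_pairs _ _]inE; case: (u \in _) => //=.
rewrite /small_pairs pairE; under [X in _ + X]eq_bigr do rewrite pairE.
rewrite exchange_big -big_split; apply: leq_sum => -[v w] _ /=.
under eq_bigr do rewrite mulrAC.
move: (a * _)%R => y.
case: (boolP (pos_le U y)) => // /andP[y0 yU] /=.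
case: (boolP (squarefree_upto y)) => [_|]; first by rewrite addSn.
rewrite /squarefree_upto negb_forall => /existsP[q]; rewrite negb_imply negbK.
case/andP=> q_pr qy; rewrite (bigD1 q) //=.
suff -> : pos_le (U %/ q ^ 2) (y / q%:R ^+ 2)%R by [].
have q0 : (q%:R != 0 :> 'F_p)%R.
  by rewrite prime_Fp_neq0 // (leq_ltn_trans (leq_ord q)).
have -> : (y / q%:R ^+ 2 = (y %/ q ^ 2)%N%:R)%R.
  by rewrite -[y in LHS]natr_Zp -{1}(divnK qy) natrM natrX mulfK // expf_neq0.
rewrite /pos_le val_Fp_nat // modn_small; last first.
  by apply: leq_ltn_trans (val_Fp_lt y p_pr); exact: leq_div.
rewrite leq_div2r // andbT divn_gt0 ?expn_gt0 ?prime_gt0 //.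
exact: dvdn_leq.
Qed.

Lemma inv_pow1_inj : {in A &, injective b1}.
Proof.
move=> v w; rewrite /inv_pow !expr1 => _ _ /invr_inj /(eq_Fp_mod p_pr).
rewrite !modn_small ?(leq_ltn_trans _ DA_p) ?leq_ord // => vw.
exact: val_inj.
Qed.

Variable U : nat.
Hypotheses (U16 : 16 <= U %/ lo ^ 2) (Up : U * 2 <= p) (lo0 : 0 < lo).
Hypothesis small : 2 ^ 56 * p ^ 9 * energy b2 8 B <=
  (U %/ lo ^ 2) ^ 8 * #|A| * #|B| ^ 8.

(** As [U %/ q ^ 2] sums to at most [U / 2], a proportion of at least
    [225 / 256 - 289 / 512 > 1 / 4] survives. The hypothesis on the energy is for the shortest
    interval, hence covers all of them. *)
Lemma good_pairs_lower (a : 'F_p) : a != 0%R ->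
  U * #|A| * #|B| <= 4 * p * #|good_pairs a U|.
Proof.
move=> a0.
have smallU U' : U %/ lo ^ 2 <= U' ->
    2 ^ 56 * p ^ 9 * energy b2 8 B <= U' ^ 8 * #|A| * #|B| ^ 8.
  move=> hU; apply: leq_trans small _.
  rewrite !leq_mul2r; apply/orP; right; apply/orP; right.
  by rewrite leq_exp2r.
have Ulo : U %/ lo ^ 2 <= U by exact: leq_div.
have := small_pairs_lower p_pr inv_pow1_inj a0 (leq_trans U16 Ulo) Up (smallU _ Ulo).
have upper (q : 'I_lo.+1) : prime q ->
    256 * p * small_pairs b1 b2 A B (a / q%:R ^+ 2)%R (U %/ q ^ 2) <=
    289 * (U %/ q ^ 2) * #|A| * #|B|.
  move=> q_pr; have hq : U %/ lo ^ 2 <= U %/ q ^ 2.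
    by rewrite leq_div2l ?expn_gt0 ?prime_gt0 // leq_exp2r // leq_ord.
  apply: (small_pairs_upper p_pr inv_pow1_inj) (smallU _ hq).
  - rewrite mulf_neq0 // invr_neq0 // expf_neq0 // prime_Fp_neq0 //.
    exact: leq_ltn_trans (leq_ord q) lo_p.
  - exact: leq_trans U16 hq.
  - by apply: leq_trans Up; rewrite leq_mul2r leq_div orbT.
have p256 : 0 < 256 * p by rewrite muln_gt0 (prime_gt0 p_pr).
have := small_pairs_le_good a U; rewrite -(leq_pmul2l p256).
rewrite mulnDr [X in _ <= _ + X]big_distrr /=.
have := leq_sum (index_enum 'I_lo.+1) upper.
set S := small_pairs _ _ _ _ a U; set G := #|_|.
set X := \sum_(i < _ | _) _; move=> h1 h2 h3.
have h4 : 2 * (\sum_(q < lo.+1 | prime q) 289 * (U %/ q ^ 2) * #|A| * #|B|) <=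
    289 * U * #|A| * #|B|.
  have -> : \sum_(q < lo.+1 | prime q) 289 * (U %/ q ^ 2) * #|A| * #|B| =
      289 * (\sum_(q < lo.+1 | prime q) (U %/ q ^ 2)) * #|A| * #|B|.
    by rewrite big_distrr /= !big_distrl.
  rewrite !mulnA !leq_mul2r; apply/orP; right; apply/orP; right.
  rewrite [2 * _]mulnC -mulnA leq_mul2l /=; exact: sum_div_prime_squares.
move: h1 h2 h3 h4; rewrite -!mulnA; move: (U * _) => Y.
move: (\sum_(_ < _ | _) _) => Z.
lia.
Qed.

End Pairs.

(** A good pair [(v, w)] yields a smooth [n = u * v * w], which by assumption has a square divisor
    [q ^ 2]. Neither [u] nor the primes [v, w > lo] allow [q <= lo]. Conversely [v] and [w] are
    prime divisors of [n], so [n] arises from at most [trunc_log 2 N ^ 2] pairs. *)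
Lemma card_good_pairs_le p lo DA DB U N (a : 'F_p) :
  prime p -> lo < p -> DA < p -> DB < p -> U < p -> U * DA * DB <= N ->
  a != 0%R ->
  (forall n, 0 < n <= N -> (n%:R = a)%R ->
     (forall q, prime q -> q %| n -> q <= p) ->
     exists2 q, prime q & q ^ 2 %| n) ->
  #|good_pairs lo DA DB a U| <=
    #|square_multiples a N (fun q => lo < q)| * trunc_log 2 N ^ 2.
Proof.
move=> p_pr lo_p DA_p DB_p Up UN a0 nosqf.
set G := good_pairs _ _ _ _ _; set S := square_multiples _ _ _.
pose y (u : 'I_DA.+1 * 'I_DB.+1) : 'F_p :=
  (a * (@inv_pow DA 1 p u.1 * @inv_pow DB 1 p u.2))%R.
pose n u := nat_of_ord (y u) * u.1 * u.2.
have GP u : u \in G -> [/\ prime u.1 && (lo < u.1), prime u.2 && (lo < u.2),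
    0 < n u <= N, ((n u)%:R = a)%R & squarefree_upto lo (y u)].
  rewrite inE => /andP[]; case: u => v w; rewrite in_setX !inE /= => /andP[hv hw].
  case/andP=> /andP[y0 yU] sq.
  have [v_pr _] := andP hv; have [w_pr _] := andP hw.
  split=> //.
    rewrite /n !muln_gt0 y0 !prime_gt0 //=; apply: leq_trans UN.
    by rewrite !leq_mul // -ltnS.
  rewrite /n !natrM natr_Zp /y /inv_pow /= !expr1.
  have v0 : ((v : nat)%:R != 0 :> 'F_p)%R.
    by rewrite prime_Fp_neq0 // (leq_ltn_trans (leq_ord v)).
  have w0 : ((w : nat)%:R != 0 :> 'F_p)%R.
    by rewrite prime_Fp_neq0 // (leq_ltn_trans (leq_ord w)).
  by field; rewrite v0 w0.
have GS u : u \in G -> (inord (n u) : 'I_N.+1) \in S.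
  move=> /GP[/andP[v_pr lv] /andP[w_pr lw] /[dup] hn /andP[n0 nN] na sq].
  have nsmooth q : prime q -> q %| n u -> q <= p.
    move=> q_pr; rewrite /n !Euclid_dvdM // => /orP[/orP[]|] /dvdn_leq h.
    - apply: ltnW; apply: leq_ltn_trans (h _) (val_Fp_lt _ p_pr).
      by move: n0; rewrite /n !muln_gt0 => /andP[/andP[]].
    - by apply: leq_trans (h (prime_gt0 v_pr)) _; rewrite ltnW // (leq_ltn_trans (leq_ord _)).
    - by apply: leq_trans (h (prime_gt0 w_pr)) _; rewrite ltnW // (leq_ltn_trans (leq_ord _)).
  have [q q_pr qn] := nosqf _ hn na nsmooth.
  have qN : q < N.+1.
    rewrite ltnS; apply: leq_trans nN; apply: leq_trans (dvdn_leq n0 qn).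
    by rewrite -mulnn leq_pmulr // prime_gt0.
  rewrite inE inordK ?ltnS // na eqxx; apply/existsP; exists (Ordinal qN).
  rewrite q_pr /= qn andbT ltnNge; apply/negP => qlo.
  have qcop r : prime r -> lo < r -> coprime (q ^ 2) r.
    move=> r_pr lr; rewrite coprimeXl // prime_coprime // dvdn_prime2 //.
    by rewrite neq_ltn (leq_ltn_trans qlo lr).
  move: qn; rewrite /n !Gauss_dvdl ?qcop // => qy.
  have qlo1 : q < lo.+1 by [].
  by have /forallP/(_ (Ordinal qlo1)) := sq; rewrite /= q_pr qy.
rewrite -sum1_card (partition_big (fun u => inord (n u) : 'I_N.+1) (mem S) GS) /=.
rewrite -sum_nat_const; apply: leq_sum => m mS.
set s := primes m.
have m_gt0 : 0 < m.
  move: mS; rewrite inE => /andP[/eqP ma _].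
  by rewrite lt0n; apply: contraNneq a0 => m0; rewrite -ma m0.
have s_le : size s <= trunc_log 2 N.
  apply: leq_trans (size_primes_log m_gt0) _; apply: leq_trunc_log.
  by rewrite -ltnS.
apply: (@leq_trans (size s ^ 2)); last by rewrite leq_exp2r.
rewrite sum1dep_card -mulnn -(size_allpairs pair).
pose F := [set u in G | inord (n u) == m].
rewrite -/F cardE -(size_map (fun u : 'I_DA.+1 * 'I_DB.+1 => (u.1 : nat, u.2 : nat))).
apply: uniq_leq_size.
  rewrite map_inj_uniq ?enum_uniq // => -[v w] [v' w'] /= [hv hw].
  by congr (_, _); apply/val_inj.
move=> z /mapP[u]; rewrite mem_enum inE => /andP[/GP[/andP[v_pr _] /andP[w_pr _]]].
move=> /andP[n0 nN] _ _ /eqP /(congr1 val) /=; rewrite inordK ?ltnS // => nm ->.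
apply: allpairs_f; rewrite mem_primes m_gt0 -nm /n ?v_pr ?w_pr /=.
  by rewrite dvdn_mulr // dvdn_mull.
by rewrite dvdn_mull.
Qed.

Lemma square_multiples_chop p (a : 'F_p) N x i k :
  #|square_multiples a N (fun q => x ^ i < q)| <=
    \sum_(j < k) #|square_multiples a N (fun q => x ^ (i + j) < q <= x ^ (i + j).+1)| +
    #|square_multiples a N (fun q => x ^ (i + k) < q)|.
Proof.
elim: k => [|k IH]; first by rewrite big_ord0 addn0.
apply: leq_trans IH _; rewrite big_ord_recr /= -addnA leq_add2l.
apply: leq_trans (leq_card_setU _ _); apply: subset_leq_card.
apply/subsetP => n; rewrite !inE => /andP[-> /existsP[q /and3P[q_pr lq qn]]] /=.
case: (leqP q (x ^ (i + k).+1)) => hq; apply/orP; [left|right];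
  by apply/existsP; exists q; rewrite q_pr qn ?lq ?hq // addnS hq.
Qed.

Lemma card_primes_between_le lo D : #|primes_between lo D| <= D.
Proof.
have h : #|[set~ (ord0 : 'I_D.+1)]| = D by rewrite cardsC1 card_ord.
rewrite -[X in _ <= X]h; apply: subset_leq_card; apply/subsetP => q; rewrite !inE => /andP[q_pr _].
by apply: contraTneq q_pr => ->.
Qed.

(* Primes are compared with powers of a base [x], so that constants and
   logarithms are absorbed by one factor [x]. The candidates are [u * v * w] with
   [u <= x ^ (12 * t - 1)], [v <= x ^ (t + 300)] and [w <= x ^ (3 * t)], whose
   product is [N]; the exponent of [v] only has to exceed [t] by a constant. *)
Section PrimeBase.
Variables (t x p : nat).
Hypotheses (t300 : 300 <= t) (x_large : 2 ^ 56 <= x) (tx : 12 * t + 2 <= x).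
Local Notation N := (x ^ (16 * t + 299)).
Hypothesis log_le : trunc_log 2 N ^ 2 <= x.
Hypotheses (p_pr : prime p) (p_range : x ^ (12 * t) <= p <= x ^ (12 * t + 1)).

Let x2 : 1 < x.
Proof. by apply: leq_trans x_large; rewrite -[X in X < _](expn0 2) ltn_exp2l. Qed.

Let x100 : 100 <= x.
Proof.
apply: leq_trans x_large; apply: (@leq_trans (2 ^ 7)); first by [].
by rewrite leq_exp2l.
Qed.

Let ple m n : m <= n -> x ^ m <= x ^ n.
Proof. by move=> mn; rewrite leq_exp2l. Qed.

Let lt_p m : m < 12 * t -> x ^ m < p.
Proof.
by have /andP[+ _] := p_range; move=> xp mt; apply: leq_trans xp; rewrite ltn_exp2l.
Qed.

(** One progression for each [q]: the terms are at most [x ^ j.+1], with [j < 3 * t], and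
    [x ^ (4 * t + 300 - j)], where [j >= 10] gives the needed saving. *)
Let scale_low (a : 'F_p) j : a != 0%R -> 10 <= j -> j < 3 * t ->
  #|square_multiples a N (fun q => x ^ j < q <= x ^ j.+1)| <= 2 * x ^ (4 * t + 290).
Proof.
move=> a0 j10 jt; have xj0 : 0 < x ^ j by rewrite expn_gt0 ltnW.
apply: leq_trans (card_square_multiples _ _ p_pr xj0 (lt_p _)) _; first by lia.
apply: (@leq_trans (x ^ j.+1 * (N %/ x ^ (12 * t + 2 * j)).+1)).
  apply: leq_mul.
    apply: leq_trans (card_primes_between_le (x ^ j) _); apply: subset_leq_card.
    by apply/subsetP => q; rewrite inE => /andP[].
  have {}xp : x ^ (12 * t + 2 * j) <= (x ^ j) ^ 2 * p.
    rewrite addnC expnD [2 * j]mulnC expnM leq_mul2l.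
    by case/andP: p_range => ->; rewrite orbT.
  by rewrite ltnS leq_div2l // expn_gt0 ltnW.
rewrite mulnS [2 * x ^ _]mul2n -addnn; apply: leq_add; first by apply: ple; lia.
have divM m d : 0 < d -> m * (N %/ d) <= m * N %/ d.
  by move=> d0; rewrite leq_divRL // -mulnA leq_mul2l leq_trunc_div orbT.
apply: leq_trans (divM _ _ _) _; first by rewrite expn_gt0 ltnW.
rewrite -expnD -expnB ?(ltnW x2) //; last by lia.
by apply: ple; lia.
Qed.

(** Since [q ^ 2 * p > N], each [q] has at most one multiple, and only the number of occurring [q]
    matters; its fourth power is bounded by [card_square_moduli]. *)
Let scale_high (a : 'F_p) j : a != 0%R -> 3 * t <= j -> j < 6 * t + 5 ->
  x ^ (12 * t) * energy (@inv_pow (x ^ j.+1) 2 p) 4 (primes_between (x ^ j) (x ^ j.+1))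
    <= x ^ 5 * (x ^ (12 * t + 2 * j + 2) + x ^ (4 * j + 4)) ->
  #|square_multiples a N (fun q => x ^ j < q <= x ^ j.+1)| <= 2 * x ^ (4 * t + 290).
Proof.
move=> a0 jt j6 hE; have xj0 : 0 < x ^ j by rewrite expn_gt0 ltnW.
have Dp : x ^ j.+1 < p by apply: lt_p; lia.
apply: leq_trans (card_square_multiples _ _ p_pr xj0 Dp) _.
rewrite divn_small ?muln1; last first.
  have /andP[xp _] := p_range.
  apply: (@leq_trans ((x ^ j) ^ 2 * x ^ (12 * t))); last by rewrite leq_mul2l xp orbT.
  by rewrite -expnM -expnD ltn_exp2l //; lia.
apply: (@leq_trans (x ^ (4 * t + 290))); last by rewrite leq_pmull.
rewrite -(@leq_exp2r _ _ 4) // -(@leq_pmul2l (x ^ (12 * t))) ?expn_gt0 ?(ltnW x2) //.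
have := card_square_moduli N p_pr a0 xj0 Dp.
move: hE; move: (energy _ _ _) (#|_|) => E R hE hR.
apply: (@leq_trans (x ^ (12 * t) * (x ^ (16 * t + 300 - 2 * j) * E))).
  rewrite leq_mul2l; apply/orP; right; apply: leq_trans hR _.
  rewrite leq_mul2r; apply/orP; right.
  rewrite -expnM -expnB ?(ltnW x2) //; last by lia.
  rewrite (_ : 16 * t + 300 - 2 * j = (16 * t + 299 - j * 2).+1); last by lia.
  rewrite expnS; have : 0 < x ^ (16 * t + 299 - j * 2) by rewrite expn_gt0 ltnW.
  move: (x ^ _) => y; nia.
rewrite mulnCA; apply: (@leq_trans (x ^ (16 * t + 300 - 2 * j) * (x ^ 5 *
   (x * x ^ (12 * t + 2 * j + 12))))).
  rewrite leq_mul2l; apply/orP; right; apply: leq_trans hE _.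
  rewrite leq_mul2l; apply/orP; right.
  have h1 : x ^ (12 * t + 2 * j + 2) <= x ^ (12 * t + 2 * j + 12) by apply: ple; lia.
  (* The range of [j] stops at [6 * t + 4] exactly to have this inequality of exponents. *)
  have h2 : x ^ (4 * j + 4) <= x ^ (12 * t + 2 * j + 12) by apply: ple; lia.
  apply: leq_trans (leq_add h1 h2) _; rewrite addnn -mul2n leq_mul2r x2 orbT //.
rewrite -expnS -!expnD -expnM -expnD; apply: ple; lia.
Qed.

Let scale_top (a : 'F_p) : a != 0%R ->
  #|square_multiples a N (fun q => x ^ (6 * t + 5) < q)| <= 4 * x ^ (4 * t + 290).
Proof.
move=> a0; have /andP[xp _] := p_range.
have x0 : 0 < x ^ (6 * t + 5) by rewrite expn_gt0 ltnW.
apply: leq_trans (card_square_multiples_large p_pr a0 x0 _) _.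
  apply: (@leq_trans ((x ^ (12 * t)) ^ 2)); last by rewrite leq_exp2r.
  by rewrite -expnM ltn_exp2l //; lia.
rewrite -expnM -expnB ?(ltnW x2) //; last by lia.
have h1 : x ^ (16 * t + 299 - (6 * t + 5) * 2) <= x ^ (4 * t + 290) by apply: ple; lia.
have : 0 < x ^ (4 * t + 290) by rewrite expn_gt0 ltnW.
by move: h1; move: (x ^ (4 * t + 290)) (x ^ _) => u v; lia.
Qed.

Local Notation A := (primes_between (x ^ 10) (x ^ (t + 300))).
Local Notation B := (primes_between (x ^ 10) (x ^ (3 * t))).
Hypotheses (card_A : x ^ (t + 298) <= #|A|) (card_B : x ^ (3 * t - 2) <= #|B|).
Hypothesis energy_B :
  energy (@inv_pow (x ^ (3 * t)) 1 p) 8 B <= x ^ (12 * t + 5).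
Hypothesis energy_scale : forall j, 3 * t <= j < 6 * t + 5 ->
  x ^ (12 * t) * energy (@inv_pow (x ^ j.+1) 2 p) 4 (primes_between (x ^ j) (x ^ j.+1))
    <= x ^ 5 * (x ^ (12 * t + 2 * j + 2) + x ^ (4 * j + 4)).

Let square_multiples_le (a : 'F_p) : a != 0%R ->
  #|square_multiples a N (fun q => x ^ 10 < q)| <= x ^ (4 * t + 291).
Proof.
move=> a0; apply: leq_trans (square_multiples_chop _ _ _ _ (6 * t - 5)) _.
rewrite (_ : 10 + (6 * t - 5) = 6 * t + 5); last by lia.
apply: (@leq_trans (\sum_(j < 6 * t - 5) 2 * x ^ (4 * t + 290) + 4 * x ^ (4 * t + 290))).
  apply: leq_add; last exact: scale_top.
  apply: leq_sum => j _; have jt := ltn_ord j.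
  case: (ltnP (10 + j) (3 * t)) => hj; first by apply: scale_low => //; lia.
  by apply: scale_high; rewrite ?energy_scale //; lia.
rewrite sum_nat_const card_ord mulnA -mulnDl.
rewrite (_ : 4 * t + 291 = (4 * t + 290).+1) ?expnS; last by lia.
rewrite leq_mul2r; apply/orP; right; lia.
Qed.

Let many_good_pairs (a : 'F_p) : a != 0%R ->
  x ^ (12 * t - 1) * #|A| * #|B| <=
    4 * p * #|good_pairs (x ^ 10) (x ^ (t + 300)) (x ^ (3 * t)) a (x ^ (12 * t - 1))|.
Proof.
have /andP[xp px] := p_range; have x1 := ltnW x2.
have lo_p : x ^ 10 < p by apply: lt_p; clear -t300; lia.
have DA_p : x ^ (t + 300) < p by apply: lt_p; clear -t300; lia.
have DB_p : x ^ (3 * t) < p by apply: lt_p; clear -t300; lia.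
have Ulo : x ^ (12 * t - 1) %/ (x ^ 10) ^ 2 = x ^ (12 * t - 21).
  by rewrite -expnM -expnB //; [congr (_ ^ _)|]; clear -t300; lia.
have U16 : 16 <= x ^ (12 * t - 1) %/ (x ^ 10) ^ 2.
  rewrite Ulo; apply: (@leq_trans (x ^ 1)); last by apply: ple; clear -t300; lia.
  by rewrite expn1; apply: leq_trans x100.
have Up : x ^ (12 * t - 1) * 2 <= p.
  have E : x ^ (12 * t) = x * x ^ (12 * t - 1).
    by rewrite -expnS; congr (_ ^ _); clear -t300; lia.
  by apply: leq_trans xp; rewrite E mulnC leq_mul2r x2 orbT.
have lo0 : 0 < x ^ 10 by rewrite expn_gt0 x1.
apply: (good_pairs_lower p_pr lo_p DA_p DB_p U16 Up lo0) => //; rewrite Ulo.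
(* The exponents to compare are [120 * t + 15] and [121 * t + 114]. *)
apply: (@leq_trans (x * (x ^ (12 * t + 1)) ^ 9 * x ^ (12 * t + 5))).
  apply: leq_mul energy_B; apply: leq_mul x_large _.
  by rewrite leq_exp2r.
apply: (@leq_trans ((x ^ (12 * t - 21)) ^ 8 * x ^ (t + 298) * (x ^ (3 * t - 2)) ^ 8)).
  rewrite -!expnM -expnS -!expnD; apply: ple; clear -t300; lia.
apply: leq_mul; last by rewrite leq_exp2r.
by apply: leq_mul.
Qed.

Lemma squarefree_representation a : exists n : nat,
  [/\ 0 < n <= N, forall q, prime q -> q %| n -> q <= p,
      forall q, prime q -> ~~ (q ^ 2 %| n) & n = a %[mod p]].
Proof.
have /andP[xp px] := p_range; have x1 := ltnW x2.
have pN : p <= N by apply: leq_trans px _; apply: ple; clear -t300; lia.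
(* The class of 0 contains [p] itself, which is [p]-smooth and square-free. *)
have [a0|a0] := eqVneq (a%:R : 'F_p)%R 0%R.
  exists p; split.
  - by rewrite prime_gt0.
  - by move=> q q_pr; rewrite dvdn_prime2 // => /eqP ->.
  - move=> q q_pr; apply/negP => qp.
    have /eqP qE : q == p.
      by rewrite -dvdn_prime2 //; apply: dvdn_trans qp; rewrite -mulnn dvdn_mull.
    have := dvdn_leq (prime_gt0 p_pr) qp.
    by rewrite qE leqNgt -[X in X < _]expn1 ltn_exp2l ?prime_gt1.
  - by rewrite modnn; apply/esym/eqP; rewrite -/(p %| a) (dvdn_pcharf (pchar_Fp p_pr)) a0.
pose good n := [&& 0 < n, (n%:R == a%:R :> 'F_p)%R, all (leq^~ p) (primes n) &
  [forall q : 'I_N.+1, prime q ==> ~~ (q ^ 2 %| n)]].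
have [/existsP[n /and4P[n0 na /allP n_smooth /forallP n_sqf]]|] :=
    boolP [exists n : 'I_N.+1, good n].
  exists n; split.
  - by rewrite n0 -ltnS ltn_ord.
  - by move=> q q_pr qn; apply: n_smooth; rewrite mem_primes q_pr n0.
  - move=> q q_pr; apply/negP => qn.
    have qN : q < N.+1.
      apply: leq_trans (ltn_ord n); rewrite ltnS; apply: leq_trans (dvdn_leq n0 qn).
      by rewrite -mulnn leq_pmulr // prime_gt0.
    by have := n_sqf (Ordinal qN); rewrite /= q_pr qn.
  - exact/(eq_Fp_mod p_pr)/eqP.
rewrite negb_exists => /forallP none; exfalso.
have nosqf n : 0 < n <= N -> (n%:R = a%:R :> 'F_p)%R ->
    (forall q, prime q -> q %| n -> q <= p) -> exists2 q, prime q & q ^ 2 %| n.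
  move=> /andP[n0 nN] na n_smooth; have nN1 : n < N.+1 by [].
  have := none (Ordinal nN1); rewrite /good /= n0 na eqxx /=.
  have -> : all (leq^~ p) (primes n).
    by apply/allP => q; rewrite mem_primes => /and3P[q_pr _ qn]; apply: n_smooth.
  rewrite negb_forall => /existsP[q]; rewrite negb_imply negbK => /andP[].
  by exists q.
have few : #|good_pairs (x ^ 10) (x ^ (t + 300)) (x ^ (3 * t)) (a%:R : 'F_p)%R
    (x ^ (12 * t - 1))| <= x ^ (4 * t + 291) * x.
  apply: (@leq_trans (#|square_multiples (a%:R : 'F_p)%R N (fun q => x ^ 10 < q)| *
                      trunc_log 2 N ^ 2)).
    apply: card_good_pairs_le => //; try by apply: lt_p; clear -t300; lia.
    by rewrite -!expnD; apply: ple; clear -t300; lia.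
  by apply: leq_mul => //; exact: square_multiples_le.
have lower : x ^ (16 * t + 295) <= x ^ (12 * t - 1) * #|A| * #|B|.
  rewrite (_ : 16 * t + 295 = 12 * t - 1 + (t + 298) + (3 * t - 2)); last by clear -t300; lia.
  rewrite expnD expnD; apply: leq_mul card_B.
  by apply: leq_mul card_A.
(* The contradiction is that [x ^ (16 * t + 295)] would be at most [4 * x ^ (16 * t + 293)]. *)
have upper := leq_mul (leq_mul (leqnn 4) px) few.
have := leq_trans lower (leq_trans (many_good_pairs a0) (leq_trans _ upper)).
rewrite -mulnA leqnn => /(_ isT); apply/negP; rewrite -ltnNge.
apply: (@leq_ltn_trans (4 * x ^ (16 * t + 293))).
  by rewrite -expnSr -mulnA -expnD leq_mul2l /=; apply: ple; clear -t300; lia.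
rewrite (_ : 16 * t + 295 = (16 * t + 294).+1) ?expnS; last by clear -t300; lia.
apply: (@leq_trans (x * x ^ (16 * t + 293))).
  by rewrite ltn_pmul2r ?expn_gt0 ?x1 //; apply: leq_trans x100.
by rewrite leq_mul2l; apply/orP; right; apply: ple; clear -t300; lia.
Qed.

End PrimeBase.

(** * Exceptional primes *)

Lemma count_markov (T : eqType) (s : seq T) (f : T -> nat) c :
  count (fun u => c < f u) s * c <= \sum_(u <- s) f u.
Proof.
rewrite -sum1_count big_distrl /= big_mkcond; apply: leq_sum => u _.
by case: ifP => // /ltnW; rewrite mul1n.
Qed.

Lemma trunc_log2_expn_le x m : 0 < x ->
  trunc_log 2 (x ^ m) <= m * (trunc_log 2 x).+1.
Proof.
move=> x0; have : x ^ m <= 2 ^ (m * (trunc_log 2 x).+1).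
  by rewrite mulnC expnM; case: m => // m; rewrite leq_exp2r // ltnW // trunc_log_ltn.
by move/(leq_trunc_log 2); rewrite trunc_expnK.
Qed.

(** Dropping the at most [x ^ 10 <= x ^ (j - 2)] small primes from the [x ^ j.-1 >= 2 * x ^ (j - 2)]
    primes up to [x ^ j] leaves enough. *)
Lemma card_primes_between_ge x j : 12 <= j -> 2 <= x ->
  4 * (j * (trunc_log 2 x).+1).+1 <= x ->
  x ^ (j - 2) <= #|primes_between (x ^ 10) (x ^ j)|.
Proof.
move=> j12 x2 hx; have j0 : 0 < j by apply: leq_trans j12.
have := prime_count_pow_ge j0 x2 hx.
set D := x ^ j; set P := [set q : 'I_D.+1 | prime q] => hP.
have hcard : #|P| <= #|primes_between (x ^ 10) D| + x ^ 10.
  have lo : #|[set q : 'I_D.+1 | 0 < q <= x ^ 10]| <= x ^ 10.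
    have c0 : 0 < x ^ 10 by rewrite expn_gt0 ltnW.
    move: (x ^ 10) c0 => c c0.
    have f_lt (q : 'I_D.+1) : minn q.-1 c.-1 < c.
      by rewrite gtn_min (prednK c0) leqnn orbT.
    rewrite -[X in _ <= X]card_ord.
    rewrite -(card_in_imset (f := fun q : 'I_D.+1 => Ordinal (f_lt q))) ?max_card //.
    move=> q r; rewrite !inE => /andP[q0 qc] /andP[r0 rc] [h]; apply/val_inj => /=.
    by clear -h q0 qc r0 rc; lia.
  apply: leq_trans (leq_add (leqnn _) lo); apply: leq_trans (leq_card_setU _ _).
  apply: subset_leq_card; apply/subsetP => q; rewrite !inE => q_pr.
  by rewrite q_pr prime_gt0 //= [q <= _]leqNgt orbN.
have h10 : x ^ 10 <= x ^ (j - 2) by rewrite leq_exp2l //; clear -j12; lia.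
have jE : j.-1 = (j - 2).+1 by clear -j12; lia.
rewrite jE expnS in hP; rewrite -(leq_add2r (x ^ 10)).
apply: leq_trans (leq_trans hP hcard); apply: leq_trans (leq_add (leqnn _) h10) _.
by rewrite addnn -mul2n leq_mul2r x2 orbT.
Qed.

(** A prime outside the conclusion of [squarefree_representation] has a large energy, either for the
    eighth moment or at one of [3 * t + 5] scales. Markov's inequality applied to [sum_energy_le]
    makes each case rare. *)
Lemma exceptional_bound t : 300 <= t -> exists x0, forall x, x0 <= x ->
  forall P : seq nat, uniq P ->
  (forall p, p \in P -> [/\ prime p, x ^ (12 * t) <= p <= x ^ (12 * t + 1) &
     ~ forall a, exists n, [/\ 0 < n <= x ^ (16 * t + 299),
         forall q, prime q -> q %| n -> q <= p,
         forall q, prime q -> ~~ (q ^ 2 %| n) & n = a %[mod p]]]) ->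
  size P <= x ^ (12 * t - 1).
Proof.
(* [K] exceeds all exponents of [x] whose logarithms occur, so that each such logarithm is at most
   [K * l], and even its square at most [x]. *)
move=> t300; pose K := 50 * t + 300.
have [x1 hx1] := polylog_le (K ^ 2) 2.
exists (maxn (2 ^ 56) (maxn K x1)) => x.
rewrite !geq_max => /and3P[x_large xK /hx1 logx] P uP PP.
have le_x c : c <= K -> c <= x by move=> cK; apply: leq_trans xK.
have x0 : 0 < x by apply: le_x; rewrite /K; clear -t300; lia.
have x2 : 1 < x by apply: le_x; rewrite /K; clear -t300; lia.
have x16 : 2 ^ 16 <= x by apply: leq_trans x_large; rewrite leq_exp2l.
pose l := (trunc_log 2 x).+1.
have logK : (K * l) ^ 2 <= x by rewrite expnMn.
have logK1 : K * l <= x.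
  by apply: leq_trans logK; rewrite -mulnn leq_pmull // muln_gt0 /= addn_gt0 orbT.
have log_pow m : m <= K -> trunc_log 2 (x ^ m) <= K * l.
  by move=> mK; apply: leq_trans (trunc_log2_expn_le m x0) _; rewrite leq_mul2r mK orbT.
have chk j : j <= 4 * t -> 4 * (j * l).+1 <= x.
  move=> jt; apply: leq_trans logK1.
  apply: (@leq_trans (4 * (j.+1 * l))).
    by rewrite leq_mul2l mulSn -[(j * l).+1]add1n leq_add2r orbT.
  by rewrite mulnA leq_mul2r; apply/orP; right; rewrite /K; clear -jt t300; lia.
have cA : x ^ (t + 298) <= #|primes_between (x ^ 10) (x ^ (t + 300))|.
  rewrite (_ : t + 298 = t + 300 - 2); last by clear; lia.
  by apply: card_primes_between_ge => //; last apply: chk; clear -t300; lia.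
have cB : x ^ (3 * t - 2) <= #|primes_between (x ^ 10) (x ^ (3 * t))|.
  by apply: card_primes_between_ge => //; last apply: chk; clear -t300; lia.
have logN : trunc_log 2 (x ^ (16 * t + 299)) ^ 2 <= x.
  apply: leq_trans logK; rewrite leq_exp2r //; apply: log_pow; rewrite /K; clear; lia.
have ple m n : m <= n -> x ^ m <= x ^ n by move=> mn; rewrite leq_exp2l.
have sP : size P <= x ^ (12 * t + 1).
  rewrite -(size_iota 1 (x ^ (12 * t + 1))); apply: uniq_leq_size => // p /PP[p_pr + _].
  by rewrite mem_iota prime_gt0 // add1n ltnS => /andP[].
have xP k p : k < 12 * t -> p \in P -> prime p /\ x ^ k < p.
  move=> kt /PP[p_pr /andP[xp _] _]; split=> //; apply: leq_trans xp.
  by rewrite ltn_exp2l.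
pose J4 p := energy (@inv_pow (x ^ (3 * t)) 1 p) 8 (primes_between (x ^ 10) (x ^ (3 * t))).
pose J2 j p := x ^ (12 * t) *
  energy (@inv_pow (x ^ j.+1) 2 p) 4 (primes_between (x ^ j) (x ^ j.+1)).
pose c2 j := x ^ 5 * (x ^ (12 * t + 2 * j + 2) + x ^ (4 * j + 4)).
have log8 m c : m < K -> c <= 8 -> trunc_log 2 (c * x ^ m) <= x.
  move=> mK c8; apply: leq_trans logK1; apply: leq_trans (log_pow _ mK).
  apply: leq_trunc_log; rewrite expnS leq_mul2r; apply/orP; right.
  by apply: leq_trans c8 _; apply: le_x; rewrite /K; clear; lia.
(* The energies sum to at most [2 * x ^ (24 * t + 2)], hence to at most [x ^ (24 * t + 3)], the
   product of the threshold and the claimed count. *)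
have n4 : count (fun p => x ^ (12 * t + 5) < J4 p) P <= x ^ (12 * t - 2).
  rewrite -(@leq_pmul2r (x ^ (12 * t + 5))) ?expn_gt0 ?x0 //.
  apply: leq_trans (count_markov _ _ _) _.
  apply: leq_trans (@sum_energy_le (x ^ (3 * t)) 1 4 _ _ _ _ P uP _) _ => //.
  - by move=> v; rewrite inE => /andP[].
  - by move=> p; apply: xP; clear -t300; lia.
  have := card_primes_between_le (x ^ 10) (x ^ (3 * t)).
  move: #|primes_between (x ^ 10) (x ^ (3 * t))| => b hb.
  have hL : trunc_log 2 (2 * 4 * (x ^ (3 * t)) ^ (1 * (2 * 4))) <= x.
    by rewrite -expnM; apply: log8 => //; rewrite /K; clear; lia.
  have hk : 4 ^ (2 * 4) <= x by rewrite (_ : 4 = 2 ^ 2) // -expnM.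
  have b4 : b ^ 4 <= x ^ (12 * t).
    rewrite (_ : 12 * t = 3 * t * 4); last by clear; lia.
    by rewrite (expnM x (3 * t) 4) leq_exp2r.
  have b8 : b ^ (2 * 4) <= x ^ (24 * t).
    rewrite -[2 * 4]/8 (_ : 24 * t = 3 * t * 8); last by clear; lia.
    by rewrite (expnM x (3 * t) 8) leq_exp2r.
  apply: leq_trans (leq_add (leq_mul sP (leq_mul hk b4)) (leq_mul b8 hL)) _.
  rewrite -expnS -expnSr -!expnD.
  apply: (@leq_trans (2 * x ^ (24 * t + 2))).
    by rewrite [2 * _]mul2n -addnn; apply: leq_add; apply: ple; clear; lia.
  apply: (@leq_trans (x * x ^ (24 * t + 2))); first by rewrite leq_mul2r x2 orbT.
  by rewrite -expnS; apply: ple; clear -t300; lia.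
(* The two summands of [c2 j] match the two of [sum_energy_le]: solutions with repeated values, and
   those due to prime divisors of nonzero numerators. *)
have n2 j : 3 * t <= j < 6 * t + 5 ->
    count (fun p => c2 j < J2 j p) P <= x ^ (12 * t - 3).
  move=> /andP[tj jt].
  have c0 : 0 < c2 j by rewrite muln_gt0 addn_gt0 !expn_gt0 x0.
  rewrite -(@leq_pmul2r (c2 j)) //.
  apply: leq_trans (count_markov _ _ _) _; rewrite -big_distrr /=.
  apply: leq_trans (leq_mul (leqnn _) (@sum_energy_le (x ^ j.+1) 2 2 _ _ _ _ P uP _)) _ => //.
  - by move=> v; rewrite inE => /andP[].
  - by move=> p; apply: xP; clear -t300 jt; lia.
  have := card_primes_between_le (x ^ j) (x ^ j.+1).
  move: #|primes_between (x ^ j) (x ^ j.+1)| => b hb.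
  have hL : trunc_log 2 (2 * 2 * (x ^ j.+1) ^ (2 * (2 * 2))) <= x.
    by rewrite -expnM; apply: log8 => //; rewrite /K; clear -jt t300; lia.
  have hk : 2 ^ (2 * 2) <= x by apply: leq_trans x16; rewrite leq_exp2l.
  have b2 : b ^ 2 <= x ^ (2 * j + 2).
    rewrite (_ : 2 * j + 2 = j.+1 * 2); last by clear; lia.
    by rewrite (expnM x j.+1 2) leq_exp2r.
  have b4 : b ^ (2 * 2) <= x ^ (4 * j + 4).
    rewrite -[2 * 2]/4 (_ : 4 * j + 4 = j.+1 * 4); last by clear; lia.
    by rewrite (expnM x j.+1 4) leq_exp2r.
  apply: leq_trans (leq_mul (leqnn _) (leq_add (leq_mul sP (leq_mul hk b2)) (leq_mul b4 hL))) _.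
  rewrite /c2 [x ^ (12 * t - 3) * _]mulnA -expnD !mulnDr -expnS -expnSr -!expnD.
  by apply: leq_add; apply: ple; clear -t300 tj jt; lia.
have cover p : p \in P -> (x ^ (12 * t + 5) < J4 p) ||
    [exists i : 'I_(3 * t + 5), c2 (3 * t + i) < J2 (3 * t + i) p].
  move=> /PP[p_pr p_range hp]; apply/negPn/negP; rewrite negb_or -leqNgt negb_exists.
  move=> /andP[h4 /forallP h2]; apply: hp => a.
  apply: squarefree_representation => //.
    by apply: le_x; rewrite /K; clear -t300; lia.
  move=> j /andP[tj jt].
  have ij : j - 3 * t < 3 * t + 5 by clear -tj jt; lia.
  by have := h2 (Ordinal ij); rewrite /= subnKC // -leqNgt.
have : size P <= count (fun p => x ^ (12 * t + 5) < J4 p) P +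
    \sum_(i < 3 * t + 5) count (fun p => c2 (3 * t + i) < J2 (3 * t + i) p) P.
  under eq_bigr do rewrite -sum1_count big_mkcond.
  rewrite exchange_big -sum1_count [X in X + _]big_mkcond -big_split /= -sum1_size.
  rewrite big_seq [X in _ <= X]big_seq; apply: leq_sum => p pP.
  case/orP: (cover p pP) => [-> //|/existsP[i hi]].
  by rewrite (bigD1 i) //= hi addnCA.
move=> hs; apply: leq_trans hs _.
apply: (@leq_trans (x ^ (12 * t - 2) + \sum_(i < 3 * t + 5) x ^ (12 * t - 3))).
  apply: leq_add n4 _; apply: leq_sum => i _; apply: n2.
  have := ltn_ord i; clear; lia.
rewrite sum_nat_const card_ord.
apply: (@leq_trans (x ^ (12 * t - 2) + x * x ^ (12 * t - 3))).
  rewrite leq_add2l leq_mul2r; apply/orP; right; apply: le_x; rewrite /K; clear; lia.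
rewrite -expnS (_ : (12 * t - 3).+1 = 12 * t - 2); last by clear -t300; lia.
rewrite (_ : 12 * t - 1 = (12 * t - 2).+1); last by clear -t300; lia.
by rewrite addnn -mul2n expnS leq_mul2r x2 orbT.
Qed.

(** * Passage to real [Q] and the asymptotic statement *)

Local Open Scope ring_scope.
Local Open Scope classical_set_scope.

Lemma M_le (R : realType) p N : represents_all_classes p N -> (M R p <= N%:R%:E)%E.
Proof.
move=> rep; rewrite /M; case: pselect => [ex|nex]; last first.
  by exfalso; apply: nex; exists N; apply/asboolP.
case: ex_minnP => m _ /(_ N); rewrite lee_fin ler_nat; apply; exact/asboolP.
Qed.

(** The last hypothesis is [n <= m * (4 / 3 + 1 / k)] with denominators cleared. *)
Lemma natpow_le_powR (R : realType) (x p m n k : nat) :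
  (0 < x)%N -> (0 < k)%N -> (x ^ m <= p)%N -> (3 * k * n <= m * (4 * k + 3))%N ->
  (x ^ n)%:R <= p%:R `^ (4 / 3 + k%:R^-1) :> R.
Proof.
move=> x0 k0 xp nm.
have x1 : 1 <= x%:R :> R by rewrite ler1n.
have r0 : 0 <= 4 / 3 + k%:R^-1 :> R by rewrite addr_ge0 ?divr_ge0 ?invr_ge0.
apply: (@le_trans _ _ ((x ^ m)%:R `^ (4 / 3 + k%:R^-1))); last first.
  by rewrite ge0_ler_powR ?nnegrE ?ler0n // ler_nat.
rewrite !natrX -!powR_mulrn ?ler0n // -powRrM ler_powR //.
have k0R : (k%:R : R) != 0 by rewrite pnatr_eq0 -lt0n.
have -> : m%:R * (4 / 3 + k%:R^-1) = (m * (4 * k + 3))%:R / (3 * k)%:R :> R.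
  by rewrite !natrM natrD natrM; field.
by rewrite ler_pdivlMr ?ltr0n ?muln_gt0 ?k0 // -natrM ler_nat mulnC.
Qed.

Lemma exceptional_eventually_le (R : realType) (k : nat) : (0 < k)%N ->
  \forall Q \near +oo,
    (#|` fset_set (exceptional_primes (fun=> k%:R^-1) Q)|)%fset%:R * k%:R * ln Q <= Q :> R.
Proof.
(* With this [t], the ratio [(16 * t + 299) / (12 * t)] is below [4 / 3 + 1 / k]. *)
move=> k0; pose t := (300 * k)%N; pose m := (12 * t)%N.
have t300 : (300 <= t)%N by rewrite /t leq_pmulr.
have m0 : (0 < m)%N by rewrite muln_gt0 /= (leq_trans _ t300).
have [x1 hx1] := exceptional_bound t300.
have [x2 hx2] := polylog_le (k * m) 1.
(* [2 ^ m.+1 <= x] gives [2 * x.+1 ^ m <= x ^ m.+1], which fits all of [[Q, 2 * Q]] below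
   [x ^ m.+1]. *)
pose X := maxn x1 (maxn x2 (2 ^ m.+1)).
near=> Q.
have Q0 : 0 < Q by near: Q; exact: nbhs_pinfty_gt.
have QX : (X%:R ^+ m <= Q) by near: Q; apply: nbhs_pinfty_ge.
pose y := Q `^ (m%:R^-1).
have mR : (m%:R : R) != 0 by rewrite pnatr_eq0 -lt0n.
have y0 : 0 <= y by apply: powR_ge0.
have ym : y ^+ m = Q.
  by rewrite -powR_mulrn // /y -powRrM mulVf // powRr1 // ltW.
(* The base is the integer part of the [m]-th root of [Q], so [Q] lies between [x ^ m] and
   [x.+1 ^ m]. *)
pose x := Num.truncn y.
have /andP[xy yx] : x%:R <= y < x.+1%:R by apply: truncn_itv.
have Xx : (X <= x)%N.
  rewrite -ltnS -(ltr_nat R); apply: le_lt_trans yx.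
  by rewrite -(@ler_pXn2r _ m) // ?nnegrE ?ler0n // ym.
move: Xx; rewrite !geq_max => /and3P[hxx1 hxx2 x2m].
have x_gt0 : (0 < x)%N by apply: leq_trans x2m; rewrite expn_gt0.
set E := exceptional_primes _ _.
have xQ : (x ^ m)%:R <= Q by rewrite natrX -ym lerXn2r // nnegrE.
have Qx : Q <= (x.+1 ^ m)%:R by rewrite natrX -ym lerXn2r ?nnegrE // ltW.
have sE : ((#|` fset_set E|)%fset <= x ^ (m - 1))%N.
  apply: (hx1 x hxx1) => [|p]; first exact: fset_uniq.
  rewrite in_fset_set; last exact: finite_exceptional_primes.
  rewrite classical_sets.inE => -[p_pr /andP[Qp pQ] pM]; split=> //.
    apply/andP; split; first by rewrite -(ler_nat R) (le_trans xQ).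
    rewrite -(ler_nat R); apply: le_trans pQ _.
    apply: (@le_trans _ _ (2 * (x.+1 ^ m)%:R)); first by rewrite ler_pM2l.
    rewrite -natrM ler_nat addn1 expnS.
    apply: (@leq_trans (2 * (2 * x) ^ m)).
      by rewrite leq_mul2l leq_exp2r //= mul2n -addnn -addn1 leq_add2l.
    by rewrite expnMn mulnA -expnS leq_mul2r x2m orbT.
  move=> rep; apply: pM; apply: (le_trans (@M_le R p (x ^ (16 * t + 299)) rep)).
  rewrite lee_fin; apply: (@natpow_le_powR _ x p m) => //.
    by rewrite -(ler_nat R) (le_trans xQ).
  by rewrite /m /t; clear; lia.
have lnQ : ln Q <= (m * (trunc_log 2 x).+1)%:R.
  apply: (@le_trans _ _ (ln (2 ^+ (m * (trunc_log 2 x).+1)))).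
    rewrite ler_ln ?posrE ?exprn_gt0 //; apply: (le_trans Qx).
    by rewrite -natrX ler_nat mulnC expnM leq_exp2r // trunc_log_ltn.
  rewrite lnXn // -[X in _ <= X]mulr1 mulr_natl ler_wMn2r //.
  by have := @le_ln1Dx R 1; apply.
apply: (@le_trans _ _ ((x ^ (m - 1))%:R * k%:R * (m * (trunc_log 2 x).+1)%:R)).
  apply: (@le_trans _ _ ((x ^ (m - 1))%:R * k%:R * ln Q)).
    have lnQ0 : 0 <= ln Q.
      by apply: ln_ge0; apply: le_trans xQ; rewrite ler1n expn_gt0 x_gt0.
    by rewrite !ler_wpM2r ?ler0n ?ler_nat.
  by rewrite ler_wpM2l ?mulr_ge0 ?ler0n.
apply: le_trans xQ; rewrite -!natrM ler_nat.
have -> : (x ^ m = x ^ (m - 1) * x)%N by rewrite -expnSr subn1 prednK.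
rewrite -mulnA leq_mul2l; apply/orP; right.
by have := hx2 x hxx2; rewrite expn1 mulnA.
Unshelve. all: by end_near.
Qed.

Local Open Scope fset_scope.

Theorem theorem1p6 (R : realType) :
  exists2 e : R -> R,
    e Q @[Q --> +oo] --> 0 &
    (fun Q : R => #|` fset_set (exceptional_primes e Q)|%:R : R^o)
      =o_ (pinfty_nbhs R) (fun Q : R => Q / ln Q : R^o).
Proof.
(* Diagonal choice: [K Q] is the largest [k] up to [Q] for which the exponent [4 / 3 + 1 / k] leaves
   at most [Q / (k * ln Q)] exceptions, and [e Q] is its inverse. *)
pose P (k : nat) (Q : R) : bool :=
  #|` fset_set (exceptional_primes (fun=> k%:R^-1) Q)|%:R * k%:R * ln Q <= Q.
pose K (Q : R) := (\max_(k < (Num.truncn Q).+1 | P k Q) k)%N.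
(* [P 0 Q] holds trivially, so the maximum is over a nonempty set and is attained. *)
have PK Q : 0 <= Q -> P (K Q) Q.
  move=> Q0; have P0 : P 0%N Q by rewrite /P mulr0 mul0r.
  have h0 : (0 < #|[pred k : 'I_(Num.truncn Q).+1 | P k Q]|)%N.
    by apply/card_gt0P; exists ord0.
  have [k Pk hk] := eq_bigmax_cond (fun k : 'I_(Num.truncn Q).+1 => k : nat) h0.
  by have -> : K Q = k by exact: hk.
have K_ge k : (0 < k)%N -> \forall Q \near +oo, (k <= K Q)%N.
  move=> k0; near=> Q.
  have PkQ : P k Q by near: Q; exact: exceptional_eventually_le.
  have kQ : (k < (Num.truncn Q).+1)%N.
    rewrite ltnS truncn_ge_nat; last by near: Q; exact: nbhs_pinfty_ge.
    by near: Q; exact: nbhs_pinfty_ge.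
  exact: (@leq_bigmax_cond _ (fun k : 'I_(Num.truncn Q).+1 => P k Q)
    (fun k => k : nat) (Ordinal kQ) PkQ).
have inv_small (d : R) : 0 < d -> exists2 k, (0 < k)%N & k%:R^-1 <= d.
  move=> d0; exists (Num.truncn d^-1).+1 => //.
  rewrite -[leRHS]invrK lef_pV2 ?posrE ?invr_gt0 ?ltr0n //.
  exact/ltW/truncnS_gt.
exists (fun Q => (K Q)%:R^-1).
  apply/cvgrPdist_le => d d0; have [k k0 kd] := inv_small d d0.
  near=> Q; have kK : (k <= K Q)%N by near: Q; exact: K_ge.
  rewrite sub0r normrN ger0_norm ?invr_ge0 //; apply: le_trans kd.
  by rewrite lef_pV2 ?posrE ?ltr0n ?ler_nat // (leq_trans k0).
apply/eqoP => d d0; have [k k0 kd] := inv_small d d0.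
near=> Q.
have kK : (k <= K Q)%N by near: Q; exact: K_ge.
have Q1 : 1 < Q by near: Q; exact: nbhs_pinfty_gt.
have lnQ : 0 < ln Q by exact: ln_gt0.
have Q0 : 0 < Q by exact: lt_trans Q1.
(* The exceptional set at [Q] depends on [e] only through [e Q], so the bound for the constant
   function applies to [e] itself. *)
have := PK Q (ltW Q0); rewrite /P => h.
rewrite !ger0_norm ?divr_ge0 ?(ltW lnQ) ?(ltW Q0) //.
rewrite mulrA ler_pdivlMr //.
have KQ0 : 0 < (K Q)%:R :> R by rewrite ltr0n (leq_trans k0).
apply: (@le_trans _ _ ((K Q)%:R^-1 * Q)).
  by rewrite ler_pdivlMl // mulrA [X in X * _]mulrC.
apply: ler_wpM2r; first exact: ltW.
apply: le_trans kd.
by rewrite lef_pV2 ?posrE ?ler_nat // ltr0n.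
Unshelve. all: by end_near.
Qed.
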